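(* Let $n\ge1$ and let $\delta>0$ be fixed. Let $S\in\mathbb{R}$ and $\mathbf b\in\mathcal H^S(\mathbf T^n)$. For $\beta<n+2$ and $t\ge0$ let $\mathbf U^{\delta,\beta}(t)\in\mathcal H^{s'}(\mathbf T^n)$, $s'=S+\max\{0,\beta-n\}$, be the solution of the peridynamic equation $\frac{d^2}{dt^2}\mathbf U=\mathcal L^{\delta,\beta}\mathbf U+\mathbf b$, $\mathbf U(0)=0$, $\frac{d}{dt}\mathbf U(0)=0$, and let $\mathbf U^{\mathcal N}(t)\in\mathcal H^{s}(\mathbf T^n)$, $s=S+2$, be the solution of the Navier–Cauchy equation $\frac{d^2}{dt^2}\mathbf U^{\mathcal N}=\mathcal N\mathbf U^{\mathcal N}+\mathbf b$, $\mathbf U^{\mathcal N}(0)=0$, $\frac{d}{dt}\mathbf U^{\mathcal N}(0)=0$. Then for each $t\ge0$ and each $0<\epsilon<2$, $$\lim_{\beta\to (n+2)^-}\mathbf U^{\delta,\beta}(t)=\mathbf U^{\mathcal N}(t)\quad\text{in }\mathcal H^{s_0}(\mathbf T^n),\qquad s_0=S+2-\epsilon.$$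
   Context: Torus and spaces: $\mathbf T^n=\prod_{i=1}^n[0,2\pi]$ with periodic identification; a periodic vector distribution $\mathbf g$ is written $\mathbf g=\sum_{k\in\mathbb{Z}^n}\widehat{\mathbf g}_k e^{ik\cdot x}$ with $\widehat{\mathbf g}_k\in\mathbb{C}^n$. For $q\in\mathbb{R}$, $\mathcal H^q(\mathbf T^n)$ is the space of periodic vector distributions with $\|\mathbf g\|^2_{\mathcal H^q}=\sum_k(1+\|k\|^2)^q\|\widehat{\mathbf g}_k\|^2<\infty$. Multipliers: with ${}_pF_q(a_1,\dots,a_p;b_1,\dots,b_q;x)=\sum_{m\ge0}\frac{(a_1)_m\cdots(a_p)_m}{(b_1)_m\cdots(b_q)_m}\frac{x^m}{m!}$, where $(a)_m=a(a+1)\cdots(a+m-1)$, set for $\nu\in\mathbb{R}^n$ $$\lambda_1(\nu)=-\|\nu\|^2\Big(3\mu\,{}_3F_4\big(1,\tfrac52,\tfrac{n+2-\beta}{2};2,\tfrac32,\tfrac{n+4}{2},\tfrac{n+4-\beta}{2};-\tfrac14\|\nu\|^2\delta^2\big)+(\lambda^*-\mu)\,{}_1F_2\big(\tfrac{n+2-\beta}{2};\tfrac{n+2}{2},\tfrac{n+4-\beta}{2};-\tfrac14\|\nu\|^2\delta^2\big)^2\Big),$$ $$\lambda_2(\nu)=-\mu\|\nu\|^2\,{}_2F_3\big(1,\tfrac{n+2-\beta}{2};2,\tfrac{n+4}{2},\tfrac{n+4-\beta}{2};-\tfrac14\|\nu\|^2\delta^2\big).$$ $M_k$ ($k\in\mathbb{Z}^n$)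 is the real symmetric $n\times n$ matrix with $M_kk=\lambda_1(k)k$, $M_kw=\lambda_2(k)w$ for $w\perp k$, and $M_0=0$; $M^{\mathcal N}_k=-(\lambda^*+\mu)k\otimes k-\mu\|k\|^2I$. The peridynamic and Navier operators act by $\mathcal L^{\delta,\beta}\mathbf u=\sum_kM_k\widehat{\mathbf u}_ke^{ik\cdot x}$ and $\mathcal N\mathbf u=\sum_kM_k^{\mathcal N}\widehat{\mathbf u}_ke^{ik\cdot x}$ (i.e. $\mathcal N\mathbf u=(\lambda^*+\mu)\nabla(\nabla\cdot\mathbf u)+\mu\Delta\mathbf u$). Solutions: the solutions are given explicitly by $$\mathbf U^{\delta,\beta}(t)=\widehat{\mathbf b}_0\frac{t^2}{2}+\sum_{0\ne k\in\mathbb{Z}^n}\left[\cos(\sqrt{-M_k}\,t)-I\right]M_k^{-1}\widehat{\mathbf b}_ke^{ik\cdot x},$$ and $\mathbf U^{\mathcal N}(t)$ by the same formula with $M_k$ replaced by $M_k^{\mathcal N}$; functions of symmetric matrices are defined by functional calculus on eigenvalues. Standing assumption: the Lamé parameters satisfy $\mu>0$, $\lambda^*+2\mu>0$ (so $-M_k^{\mathcal N}$ is positive definite for $k\ne0$), and are such that $\lambda_1(\nu)<0$ for all $\nu\ne0$ and all parameter values under consideration (and $\lambda_2(\nu)<0$ for all $\nu\ne0$). *)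

(* Defs.v *)
(* MathComp / MathComp-Analysis. *)
From HB Require Import structures.
From mathcomp Require Import all_boot all_order all_algebra.
From mathcomp Require Import all_classical all_reals all_analysis.
From mathcomp Require Import complex.
From mathcomp Require Import ring lra.
Set Implicit Arguments.
Unset Strict Implicit.
Unset Printing Implicit Defensive.
Import Order.TTheory GRing.Theory Num.Theory.
Import numFieldNormedType.Exports.
Import Normc.
Local Open Scope classical_set_scope.
Local Open Scope complex_scope.
Local Open Scope ring_scope.

Definition pochhammer (R : realType) (a : R) (m : nat) : R :=
  \prod_(j < m) (a + j%:R).

(* Generalized hypergeometric function pFq(a; b; x). [limn] is the sum of the
   series when it converges, which is the case for all x when no lower parameter
   is a nonpositive integer and size a <= size b. *)
Definition pFq (R : realType) (a b : seq R) (x : R) : R :=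
  limn (series (fun m : nat =>
    (\prod_(c <- a) pochhammer c m) / (\prod_(c <- b) pochhammer c m)
      * (x ^+ m / m`!%:R))).

Definition sqnorm (R : realType) (n : nat) (v : 'cV[R]_n) : R :=
  \sum_(i < n) v i 0 ^+ 2.

Section Multipliers.
Context {R : realType} (n : nat).
Variables (mu lam delta beta : R).

Definition lambda1 (v : 'cV[R]_n) : R :=
  let N := n%:R : R in
  let x := - (1 / 4) * sqnorm v * delta ^+ 2 in
  - sqnorm v *
    (3 * mu *
       pFq [:: 1; 5 / 2; (N + 2 - beta) / 2]
           [:: 2; 3 / 2; (N + 4) / 2; (N + 4 - beta) / 2] x
     + (lam - mu) *
       pFq [:: (N + 2 - beta) / 2]
           [:: (N + 2) / 2; (N + 4 - beta) / 2] x ^+ 2).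

Definition lambda2 (v : 'cV[R]_n) : R :=
  let N := n%:R : R in
  let x := - (1 / 4) * sqnorm v * delta ^+ 2 in
  - mu * sqnorm v *
    pFq [:: 1; (N + 2 - beta) / 2]
        [:: 2; (N + 4) / 2; (N + 4 - beta) / 2] x.

End Multipliers.

Definition freq (R : realType) (n : nat) (k : 'cV[int]_n) : 'cV[R]_n :=
  map_mx intr k.
Arguments freq R {n} k.

(* Functional calculus for the symmetric matrix with eigenvalue l1 on the line
   spanned by k and l2 on its orthogonal complement (k != 0): [freq_fun f l1 l2 k]
   is f applied to that matrix, and f = id gives the matrix itself. *)
Definition freq_proj (R : realType) (n : nat) (k : 'cV[int]_n) : 'M[R]_n :=
  let v := freq R k in (sqnorm v)^-1 *: (v *m v^T).
Arguments freq_proj R {n} k.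

Definition freq_fun (R : realType) (n : nat) (f : R -> R) (l1 l2 : R)
    (k : 'cV[int]_n) : 'M[R]_n :=
  f l1 *: freq_proj R k + f l2 *: (1%:M - freq_proj R k).

(* Zero for k = 0; the lemmas peridynamic_mx0, peridynamic_mx_sym,
   peridynamic_mx_freq and peridynamic_mx_orth characterize it. *)
Definition peridynamic_mx (R : realType) (n : nat) (mu lam delta beta : R)
    (k : 'cV[int]_n) : 'M[R]_n :=
  let v := freq R k in
  if k == 0 then 0 else
    freq_fun id (lambda1 mu lam delta beta v) (lambda2 mu delta beta v) k.

Definition navier_mx (R : realType) (n : nat) (mu lam : R)
    (k : 'cV[int]_n) : 'M[R]_n :=
  let v := freq R k in
  - (lam + mu) *: (v *m v^T) - (mu * sqnorm v)%:M.

Section MultiplierMxTheory.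
Context {R : realType} (n : nat).
Variables (mu lam delta beta : R) (k : 'cV[int]_n).
Local Notation v := (freq R k).
Local Notation M := (peridynamic_mx mu lam delta beta k).

Lemma mul_tr_self (u : 'cV[R]_n) : u^T *m u = (sqnorm u)%:M.
Proof.
apply/matrixP => i j; rewrite !ord1 !mxE /=; apply: eq_bigr => l _.
by rewrite !mxE expr2.
Qed.

Lemma freq_sqnorm_neq0 : k != 0 -> sqnorm v != 0.
Proof.
apply: contra => /eqP s0; apply/eqP/matrixP => i j; rewrite ord1 mxE.
have /psumr_eq0P H : forall i : 'I_n, true -> 0 <= v i 0 ^+ 2.
  by move=> l _; exact: sqr_ge0.
have /eqP := H s0 i isT.
by rewrite sqrf_eq0 mxE intr_eq0 => /eqP.
Qed.

Lemma trmxZ m p (a : R) (A : 'M[R]_(m, p)) : (a *: A)^T = a *: A^T.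
Proof. by apply/matrixP => i j; rewrite !mxE. Qed.

Lemma peridynamic_mx0 : k = 0 -> M = 0.
Proof. by move=> k0; rewrite /peridynamic_mx k0 eqxx. Qed.

Lemma peridynamic_mx_sym : M^T = M.
Proof.
have vvT : (v *m v^T)^T = v *m v^T by rewrite trmx_mul trmxK.
rewrite /peridynamic_mx /freq_fun /freq_proj /=; case: eqP => _; first exact: trmx0.
by rewrite raddfD /= !trmxZ raddfB /= trmx1 trmxZ vvT.
Qed.

Lemma peridynamic_mx_freq :
  M *m v = lambda1 mu lam delta beta v *: v.
Proof.
rewrite /peridynamic_mx /freq_fun /freq_proj /=; case: (eqVneq k 0) => [-> | k0].
  have -> : freq R (0 : 'cV[int]_n) = 0 by apply/matrixP => i j; rewrite !mxE.
  by rewrite mulmx0 scaler0.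
have P : (sqnorm v)^-1 *: (v *m v^T) *m v = v.
  rewrite -scalemxAl -mulmxA mul_tr_self mul_mx_scalar scalerA.
  by rewrite mulVf ?scale1r // freq_sqnorm_neq0.
by rewrite mulmxDl -!scalemxAl mulmxBl mul1mx scalemxAl P subrr scaler0 addr0.
Qed.

Lemma peridynamic_mx_orth (w : 'cV[R]_n) : k != 0 -> v^T *m w = 0 ->
  M *m w = lambda2 mu delta beta v *: w.
Proof.
move=> k0 vw; rewrite /peridynamic_mx (negbTE k0) /freq_fun /freq_proj /= mulmxDl -!scalemxAl mulmxBl.
by rewrite mul1mx -!scalemxAl -mulmxA vw mulmx0 !scaler0 add0r subr0.
Qed.

Lemma navier_mxE : k != 0 ->
  navier_mx mu lam k =
  freq_fun id (- (lam + 2 * mu) * sqnorm v) (- mu * sqnorm v) k.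
Proof.
move=> /freq_sqnorm_neq0 s0; rewrite /navier_mx /freq_fun /freq_proj /=.
move: (v *m v^T) (sqnorm v) s0 => P s s0.
apply/matrixP => i j; rewrite !mxE -[_ *+ (i == j)]mulr_natr.
by field.
Qed.

Lemma navier_mx0 : k = 0 -> navier_mx mu lam k = 0.
Proof.
move=> ->; have v0 : freq R (0 : 'cV[int]_n) = 0.
  by apply/matrixP => i j; rewrite !mxE.
have s0 : sqnorm (0 : 'cV[R]_n) = 0.
  by rewrite /sqnorm big1 // => i _; rewrite mxE expr0n.
by rewrite /navier_mx v0 s0 mul0mx scaler0 mulr0 raddf0 subrr.
Qed.

End MultiplierMxTheory.

Section Torus.
Context {R : realType} (n : nat).

(* A periodic vector distribution is represented by the family of its Fourier
   coefficients. The polynomial growth of the coefficients of a distribution is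
   not imposed here; it follows from membership in a Sobolev space. *)
Definition pdistr : Type := 'cV[int]_n -> 'cV[R[i]]_n.

Definition sqnormC (z : 'cV[R[i]]_n) : R := \sum_(i < n) normc (z i 0) ^+ 2.

Definition Hnorm (q : R) (g : pdistr) : \bar R :=
  poweR (\esum_(k in [set: 'cV[int]_n])
           ((1 + sqnorm (freq R k)) `^ q * sqnormC (g k))%:E)%E 2^-1.

Definition inH (q : R) (g : pdistr) : Prop := (Hnorm q g < +oo)%E.

Definition cvg_inH (T : Type) (F : set_system T) (q : R)
    (f : T -> pdistr) (g : pdistr) : Prop :=
  [/\ \forall x \near F, inH q (f x), inH q g &
      Hnorm q (fun k => f x k - g k) @[x --> F] --> 0%E].

Definition fourier_multiplier (M : 'cV[int]_n -> 'M[R]_n) (g : pdistr) : pdistr :=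
  fun k => map_mx (real_complex R) (M k) *m g k.

(* f'(t) = g in the sense of distributions on the torus, i.e. coefficient by
   coefficient; the difference quotient only involves times t + h >= 0, so the
   derivative at t = 0 is one-sided. *)
Definition time_derivative (f : R -> pdistr) (t : R) (g : pdistr) : Prop :=
  forall (k : 'cV[int]_n) (i : 'I_n),
    normc ((h^-1)%:C * (f (t + h) k i 0 - f t k i 0) - g k i 0)
      @[h --> within [set h | 0 <= t + h] 0^'] --> (0 : R).

(* U : [0, +oo) -> H^s solves U'' = A U + b, U(0) = 0, U'(0) = 0, with V = U'. *)
Definition is_solution (A : pdistr -> pdistr) (b : pdistr) (s : R)
    (U : R -> pdistr) : Prop :=
  (forall t : R, 0 <= t -> inH s (U t)) /\
  exists V : R -> pdistr,
    [/\ forall k, U 0 k = 0,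
        forall k, V 0 k = 0,
        forall t : R, 0 <= t -> time_derivative U t (V t) &
        forall t : R, 0 <= t ->
          time_derivative V t (fun k => A (U t) k + b k)].

End Torus.
Arguments pdistr R n : clear implicits.

Definition peridynamic_op (R : realType) (n : nat) (mu lam delta beta : R) :
    pdistr R n -> pdistr R n :=
  fourier_multiplier (peridynamic_mx mu lam delta beta).

Definition navier_op (R : realType) (n : nat) (mu lam : R) :
    pdistr R n -> pdistr R n :=
  fourier_multiplier (navier_mx mu lam).

Section ExplicitSolution.
Context {R : realType} (n : nat).

(* t^2/2 b_0 + sum_(k != 0) [cos (sqrt (- M_k) t) - I] M_k^-1 b_k e^(ik.x), where
   M_k = freq_fun id (l1 k) (l2 k) k. *)
Definition explicit_solution (l1 l2 : 'cV[int]_n -> R) (b : pdistr R n)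
    (t : R) : pdistr R n := fun k =>
  if k == 0 then (t ^+ 2 / 2)%:C *: b 0 else
  map_mx (real_complex R)
    (freq_fun (fun x => (cos (Num.sqrt (- x) * t) - 1) / x) (l1 k) (l2 k) k)
    *m b k.

Definition explicit_velocity (l1 l2 : 'cV[int]_n -> R) (b : pdistr R n)
    (t : R) : pdistr R n := fun k =>
  if k == 0 then t%:C *: b 0 else
  map_mx (real_complex R)
    (freq_fun (fun x => sin (Num.sqrt (- x) * t) / Num.sqrt (- x)) (l1 k) (l2 k) k)
    *m b k.

Lemma freq_projM (k : 'cV[int]_n) : freq_proj R k *m freq_proj R k = freq_proj R k.
Proof.
rewrite /freq_proj; set v := freq R k.
rewrite -scalemxAl -scalemxAr scalerA mulmxA -(mulmxA v) mul_tr_self.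
rewrite mul_mx_scalar -scalemxAl scalerA.
have [->|s0] := eqVneq (sqnorm v) 0; first by rewrite invr0 !(mulr0, mul0r, scale0r).
by rewrite -mulrA mulVf // mulr1.
Qed.

Lemma freq_funM (f g : R -> R) l1 l2 (k : 'cV[int]_n) :
  freq_fun f l1 l2 k *m freq_fun g l1 l2 k =
  freq_fun (fun x => f x * g x) l1 l2 k.
Proof.
rewrite /freq_fun; move: (freq_projM k); move: (freq_proj R k) => P PP.
have PQ : P *m (1%:M - P) = 0 by rewrite mulmxBr mulmx1 PP subrr.
have QP : (1%:M - P) *m P = 0 by rewrite mulmxBl mul1mx PP subrr.
have QQ : (1%:M - P) *m (1%:M - P) = 1%:M - P by rewrite mulmxBl mul1mx PQ subr0.
rewrite mulmxDl 2!mulmxDr -!scalemxAl -!scalemxAr PP PQ QP QQ.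
by rewrite !scaler0 addr0 add0r !scalerA.
Qed.

Lemma derivative_pair (a c : R -> R) (t da dc : R) (z w : R[i]) :
  is_derive t 1 a da -> is_derive t 1 c dc ->
  normc ((h^-1)%:C * (((a (t + h))%:C * z + (c (t + h))%:C * w)
     - ((a t)%:C * z + (c t)%:C * w)) - (da%:C * z + dc%:C * w))
      @[h --> within [set h | 0 <= t + h] 0^'] --> (0 : R).
Proof.
have D (f : R -> R) df : is_derive t 1 f df ->
    (h^-1 * (f (t + h) - f t) - df) @[h --> within [set h | 0 <= t + h] 0^'] --> (0 : R).
  move=> [fd <-]; apply: cvg_within_filter.
  have H : h^-1 * (f (t + h) - f t) @[h --> 0^'] --> 'D_1 f t.
    have : h^-1 *: (f (h *: 1 + t) - f t) @[h --> 0^'] --> 'D_1 f t by exact: fd.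
    under eq_fun do rewrite /GRing.scale /= mulr1 (addrC _ t).
    exact.
  have H2 := cvgB H (cvg_cst ('D_1 f t)); rewrite subrr in H2; exact: H2.
move=> /D Da /D Dc.
apply: (@squeeze_cvgr _ _ _ _ (fun=> 0)
  (fun h => `|h^-1 * (a (t + h) - a t) - da| * normc z
          + `|h^-1 * (c (t + h) - c t) - dc| * normc w)); last 2 first.
- exact: cvg_cst.
- have N0 (f : R -> R) s : f h @[h --> within [set h | 0 <= t + h] 0^'] --> (0:R) ->
    `|f h| * s @[h --> within [set h | 0 <= t + h] 0^'] --> (0:R).
    move=> /cvg_norm; rewrite normr0 => f0.
    by rewrite -[X in _ --> X](mul0r s); apply: cvgMr_tmp.
  by rewrite -[X in _ --> X](addr0 0); apply: cvgD; apply: N0.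
apply: nearW => h; apply/andP; split.
  by case: (X in normc X) => ? ?; exact: sqrtr_ge0.
have nR (r : R) (x : R[i]) : normc (r%:C * x) = `|r| * normc x.
  by rewrite normcM /= expr0n /= addr0 sqrtr_sqr.
rewrite -!nR; apply: le_trans (le_normcD _ _); rewrite le_eqVlt; apply/orP; left; apply/eqP.
congr normc; rewrite !(rmorphB, rmorphM) /=; ring.
Qed.


Lemma derivative_single (a : R -> R) (t da : R) (z : R[i]) :
  is_derive t 1 a da ->
  normc ((h^-1)%:C * ((a (t + h))%:C * z - (a t)%:C * z) - da%:C * z)
      @[h --> within [set h | 0 <= t + h] 0^'] --> (0 : R).
Proof.
move=> d1; have := derivative_pair z 0 d1 (is_derive_cst (0 : R) t 1).
apply: cvg_trans; apply: near_eq_cvg; apply: nearW => h.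
by rewrite !mulr0 !addr0.
Qed.

Lemma mulmx_freq_fun (f : R -> R) l1 l2 (k : 'cV[int]_n) (z : 'cV[R[i]]_n) i :
  (map_mx (real_complex R) (freq_fun f l1 l2 k) *m z) i 0 =
  (f l1)%:C * (map_mx (real_complex R) (freq_proj R k) *m z) i 0 +
  (f l2)%:C * (map_mx (real_complex R) (1%:M - freq_proj R k) *m z) i 0.
Proof.
rewrite /freq_fun map_mxD !map_mxZ mulmxDl -!scalemxAl.
by rewrite mxE [X in X + _]mxE [X in _ + X]mxE.
Qed.

(* The explicit formula satisfies the initial conditions and the equation
   required by [is_solution]. *)
Lemma explicit_solutionP (l1 l2 : 'cV[int]_n -> R) (M : 'cV[int]_n -> 'M[R]_n) b :
  (forall k, k != 0 -> l1 k < 0 /\ l2 k < 0) ->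
  M 0 = 0 -> (forall k, k != 0 -> M k = freq_fun id (l1 k) (l2 k) k) ->
  let U := explicit_solution l1 l2 b in
  let V := explicit_velocity l1 l2 b in
    [/\ forall k, U 0 k = 0,
        forall k, V 0 k = 0,
        forall t : R, 0 <= t -> time_derivative U t (V t) &
        forall t : R, 0 <= t ->
          time_derivative V t (fun k => fourier_multiplier M (U t) k + b k)].
Proof.
move=> l_lt0 M0 Mk U V; split.
- move=> k; rewrite /U /explicit_solution; case: eqP => _.
    by rewrite expr0n /= mul0r scale0r.
  by apply/matrixP => i j; rewrite ord1 mulmx_freq_fun !mulr0 cos0 subrr !mul0r !(rmorph0, mul0r, addr0) mxE.
- move=> k; rewrite /V /explicit_velocity; case: eqP => _; first by rewrite scale0r.
  by apply/matrixP => i j; rewrite ord1 mulmx_freq_fun !mulr0 sin0 !mul0r !(rmorph0, mul0r, addr0) mxE.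
- move=> t _ k i; rewrite /U /V /explicit_solution /explicit_velocity.
  have [k0|k0] := eqVneq k 0.
    under eq_fun do rewrite 3!mxE.
    have d1 : is_derive t 1 (fun t => t ^+ 2 / 2) t.
      by apply: is_derive_eq; rewrite /GRing.scale /=; lra.
    exact: derivative_single.
  under eq_fun do rewrite !mulmx_freq_fun.
  have D x : x < 0 -> is_derive t 1 (fun t => (cos (Num.sqrt (- x) * t) - 1) / x)
      (sin (Num.sqrt (- x) * t) / Num.sqrt (- x)).
    move=> x0; have s0 : Num.sqrt (- x) != 0 by rewrite sqrtr_eq0 -ltNge oppr_gt0.
    have sx : Num.sqrt (- x) ^+ 2 = - x by rewrite sqr_sqrtr // oppr_ge0 ltW.
    have x_eq : x = - Num.sqrt (- x) ^+ 2 by rewrite sx opprK.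
    apply: is_derive_eq; rewrite /GRing.scale /=.
    move: s0 x_eq; set s := Num.sqrt _ => s0 ->; field; exact: s0.
  have [l1_lt0 l2_lt0] := l_lt0 _ k0.
  exact: (derivative_pair _ _ (D _ l1_lt0) (D _ l2_lt0)).
- move=> t _ k i; rewrite /V /explicit_velocity /fourier_multiplier.
  have [k0|k0] := eqVneq k 0.
    rewrite k0 M0 map_mx0 mul0mx add0r.
    under eq_fun do rewrite 2!mxE.
    have := derivative_single (b 0 i 0) (is_derive_id t 1).
    by rewrite mul1r.
  have [l1_lt0 l2_lt0] := l_lt0 _ k0.
  rewrite Mk // /U /explicit_solution (negbTE k0) mulmxA -map_mxM freq_funM.
  have -> : freq_fun (fun x => x * ((cos (Num.sqrt (- x) * t) - 1) / x))
      (l1 k) (l2 k) k =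
      freq_fun (fun x => cos (Num.sqrt (- x) * t)) (l1 k) (l2 k) k - 1%:M.
    rewrite /freq_fun; move: (freq_proj R k) => P.
    rewrite !(mulrC _ (_ / _)) !divfK ?lt_eqF //.
    by rewrite !scalerBl !scale1r addrACA -opprD subrKC.
  rewrite map_mxB map_mx1 mulmxBl mul1mx subrK.
  under eq_fun do rewrite !mulmx_freq_fun.
  have D x : x < 0 ->
      is_derive t 1 (fun t => sin (Num.sqrt (- x) * t) / Num.sqrt (- x))
        (cos (Num.sqrt (- x) * t)).
    move=> x0; have s0 : Num.sqrt (- x) != 0 by rewrite sqrtr_eq0 -ltNge oppr_gt0.
    by apply: is_derive_eq; rewrite /GRing.scale /=; field; exact: s0.
  exact: (derivative_pair _ _ (D _ l1_lt0) (D _ l2_lt0)).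
Qed.

Lemma explicit_solution_peridynamic (mu lam delta beta : R) (b : pdistr R n) :
  (forall v : 'cV[R]_n, v != 0 -> lambda1 mu lam delta beta v < 0) ->
  (forall v : 'cV[R]_n, v != 0 -> lambda2 mu delta beta v < 0) ->
  let l1 k := lambda1 mu lam delta beta (freq R k) in
  let l2 k := lambda2 mu delta beta (freq R k) in
  let U := explicit_solution l1 l2 b in
  let V := explicit_velocity l1 l2 b in
    [/\ forall k, U 0 k = 0,
        forall k, V 0 k = 0,
        forall t : R, 0 <= t -> time_derivative U t (V t) &
        forall t : R, 0 <= t -> time_derivative V t
          (fun k => peridynamic_op mu lam delta beta (U t) k + b k)].
Proof.
move=> l1_lt0 l2_lt0 l1 l2; apply: explicit_solutionP.
- move=> k /(@freq_sqnorm_neq0 R) s0; have v0 : freq R k != 0.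
    apply: contraNneq s0 => ->; rewrite /sqnorm big1 // => i _.
    by rewrite mxE expr0n.
  by split; [exact: l1_lt0 | exact: l2_lt0].
- exact: peridynamic_mx0.
- by move=> k k0; rewrite /peridynamic_mx (negbTE k0).
Qed.

Lemma explicit_solution_navier (mu lam : R) (b : pdistr R n) :
  0 < mu -> 0 < lam + 2 * mu ->
  let l1 k := - (lam + 2 * mu) * sqnorm (freq R k) in
  let l2 k := - mu * sqnorm (freq R k) in
  let U := explicit_solution l1 l2 b in
  let V := explicit_velocity l1 l2 b in
    [/\ forall k, U 0 k = 0,
        forall k, V 0 k = 0,
        forall t : R, 0 <= t -> time_derivative U t (V t) &
        forall t : R, 0 <= t -> time_derivative V t
          (fun k => navier_op mu lam (U t) k + b k)].
Proof.
move=> mu0 lm0 l1 l2; apply: explicit_solutionP.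
- move=> k /(@freq_sqnorm_neq0 R) s0.
  have sp : 0 < sqnorm (freq R k).
    by rewrite lt_def s0 sumr_ge0 // => i _; exact: sqr_ge0.
  by rewrite /l1 /l2 !nmulr_rlt0 ?oppr_lt0.
- exact: navier_mx0.
- by move=> k; exact: navier_mxE.
Qed.

End ExplicitSolution.

(* Main.v *)
Require Import Defs.
From mathcomp Require Import all_boot all_order all_algebra.
From mathcomp Require Import all_classical all_reals all_analysis.
From mathcomp Require Import complex.
From mathcomp Require Import finmap ring lra.
Set Implicit Arguments.
Unset Strict Implicit.
Unset Printing Implicit Defensive.
Import Order.TTheory GRing.Theory Num.Theory.
Import numFieldNormedType.Exports.
Import Normc.
Local Open Scope classical_set_scope.
Local Open Scope ring_scope.

(** Mode by mode both equations are linear second order systems, whose only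
    solution with zero initial data is the explicit formula (a Gronwall argument,
    [linear_ode_unique] and [fourier_ode_unique]).  The claim is therefore
    dominated convergence ([tannery]) for the sum over [k] of
      [(1 + |k|^2)^(S + 2 - eps) |U_k - UN_k|^2].
    A single mode converges because both multipliers tend to the Navier ones.
    Since the solution operator [x |-> (cos (sqrt (- x) t) - 1) / x] is bounded by
    [2 / |x|], domination by a multiple of [(1 + |k|^2)^S |b_k|^2] follows from
      [- lambda_i (k) >= M (1 + |k|^2)^(1 - eps / 2)],   [k != 0],   [i = 1, 2],
    with the same [M > 0] for all [beta] close to [n + 2].  This uniform bound is
    the heart of the proof.

    Put [a = (n + 2 - beta) / 2], which decreases to [0], and
    [y = |nu|^2 delta^2 / 4].  Every hypergeometric function in the multipliers has
    a parameter [a] above and [a + 1] below, and [(a)_m / (a + 1)_m = a / (a + m)],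
    so it is a power mean
      [F y = sum_m a / (a + m) h_m y^m = a int_0^1 s^(a - 1) H (s y) ds]
    of an entire function [H] independent of [a] with [H 0 = 1].  The equation
    [(y^a F)' = a y^(a - 1) H] shows that when [H y = O (y^(-1/2))] the function
    [y^a F] changes by [O (a)] only for [y >= 1]; as [F = 1 + O (a)] for [y <= 1],
      [F y = (1 + O (a)) tau],   [tau = max (1, y)^(- a)],
    uniformly in [y >= 0] ([pmean_cutoff_pow]).  Consequently
      [- lambda_1 = |nu|^2 tau (3 mu + (lam - mu) tau + O (a))],
      [- lambda_2 = |nu|^2 tau (mu + O (a))],
    and as [0 < tau <= 1] the bracket of [lambda_1] lies between [3 mu] and
    [lam + 2 mu] up to [O (a)], hence is bounded below ([lambda_cutoff]).  Finally
    [|nu|^2 tau] is at least a multiple of [(1 + |nu|^2)^(1 - eps / 2)] as soon as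
    [a <= eps / 2] ([sqnorm_cutoff_ge]).

    The decay of [H] is elementary: the three functions [H] are combinations of
    confluent limit functions [K_c = 0F1(; c; - x)], that is, of rescaled Bessel
    functions.  By Bessel's equation [x K'' + c K' + K = 0] the energy
    [K^2 + x K'^2] is nonincreasing for [c >= 1/2], and [K'] is a multiple of
    [K_(c + 1)] ([bessel_energy], [bessel_decay]). *)

(** * Power series with exponentially dominated coefficients *)

Section ExpDominatedSeries.
Context {R : realType}.
Implicit Types (c d : nat -> R) (x B p q : R).

Definition psum c x : R := limn (pseries c x).

(** This class contains all the coefficient sequences below and is stable under
    differentiation, so their sums are entire and can be differentiated
    termwise at every point. *)
Definition exp_dominated B c := forall m, `|c m| <= B / m`!%:R.

Lemma exp_dominated_ge0 B c : exp_dominated B c -> 0 <= B.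
Proof. by move=> /(_ 0%N); rewrite fact0 divr1; exact: le_trans. Qed.

Lemma exp_dominated_le B c (a : nat -> R) : exp_dominated B c ->
  (forall m, `|a m| <= 1) -> exp_dominated B (fun m => a m * c m).
Proof.
move=> cB a1 m; rewrite normrM -[leRHS]mul1r; apply: ler_pM => //.
Qed.

Lemma psum_normed_cvg B c x : exp_dominated B c ->
  cvgn [normed pseries c x] /\ limn [normed pseries c x] <= B * expR `|x|.
Proof.
move=> cB; have B0 := exp_dominated_ge0 cB.
have le_exp m : `|c m * x ^+ m| <= (B *: exp_coeff `|x|) m.
  rewrite /exp_coeff normrM normrX.
  have -> : (B *: (fun n => `|x| ^+ n / n`!%:R)) m = B / m`!%:R * `|x| ^+ m.
    by rewrite [LHS]mulrA mulrAC.
  by rewrite ler_wpM2r ?exprn_ge0.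
have ec : cvgn (series (B *: exp_coeff `|x|)).
  exact/is_cvg_seriesZ/is_cvg_series_exp_coeff.
have nc : cvgn [normed pseries c x].
  apply: (series_le_cvg _ _ le_exp ec) => m; first exact: normr_ge0.
  exact: le_trans (normr_ge0 _) (le_exp m).
split=> //; apply: le_trans (lim_series_le nc ec le_exp) _.
by rewrite lim_seriesZ //; exact: is_cvg_series_exp_coeff.
Qed.

Lemma psum_cvg B c x : exp_dominated B c -> cvgn (pseries c x).
Proof. by move=> /(psum_normed_cvg x)[/normed_cvg]. Qed.

Lemma psum_le B c x : exp_dominated B c -> `|psum c x| <= B * expR `|x|.
Proof.
move=> /(psum_normed_cvg x)[ncv]; apply: le_trans.
exact: lim_series_norm.
Qed.

Lemma exp_dominated_diffs B c :
  exp_dominated B c -> exp_dominated B (pseries_diffs c).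
Proof.
move=> cB m; rewrite /pseries_diffs normrM normr_nat.
apply: le_trans (ler_wpM2l _ (cB m.+1)) _; first exact: ler0n.
by rewrite factS natrM invfM mulrCA mulVKf ?pnatr_eq0.
Qed.

Lemma is_derive_psum B c x : exp_dominated B c ->
  is_derive x 1 (psum c) (psum (pseries_diffs c) x).
Proof.
move=> cB; have cB' := exp_dominated_diffs cB.
have lt_x : `|x| < `|(`|x| + 1 : R)|.
  by rewrite [ltRHS]ger0_norm ?addr_ge0// ltrDl.
apply: (pseries_snd_diffs _ _ _ lt_x).
- exact: psum_cvg cB.
- exact: psum_cvg cB'.
- exact: psum_cvg (exp_dominated_diffs cB').
Qed.

Lemma psum_linear B B' c d p q x : exp_dominated B c -> exp_dominated B' d ->
  psum (fun m => p * c m + q * d m) x = p * psum c x + q * psum d x.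
Proof.
move=> cB dB; have cc := psum_cvg (x := x) cB; have dc := psum_cvg (x := x) dB.
apply/cvg_lim => //.
have -> : pseries (fun m => p * c m + q * d m) x =
    (fun n => p * pseries c x n + q * pseries d x n).
  apply/funext => n; rewrite /pseries /series /= !mulr_sumr -big_split /=.
  by apply: eq_bigr => i _; rewrite mulrDl !mulrA.
by apply: cvgD; apply: cvgMl_tmp.
Qed.

Lemma psum_delta x : psum (fun m => (m == 0)%:R) x = 1 :> R.
Proof.
apply: lim_near_cst => //; exists 1%N => // -[//|n] _ /=.
rewrite /pseries /series /= big_nat_recl// big1 => [|i _].
  by rewrite eqxx expr0 mulr1 addr0.
by rewrite mul0r.
Qed.

Lemma exp_dominated_delta : @exp_dominated 1 (fun m => (m == 0)%:R).
Proof. by case=> [|m] /=; rewrite ?normr1 ?normr0 ?fact0 ?divr1. Qed.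

Lemma psum0 (c : nat -> R) : psum c 0 = c 0%N.
Proof.
apply: lim_near_cst => //; exists 1%N => // -[//|n] _ /=.
rewrite /pseries /series /= big_nat_recl// big1 => [|i _].
  by rewrite expr0 mulr1 addr0.
by rewrite expr0n mulr0.
Qed.

Lemma psum_mulX B c x : exp_dominated B c ->
  x * psum c x = psum (fun m => if m is m'.+1 then c m' else 0) x.
Proof.
move=> cB; have cc := psum_cvg (x := x) cB; apply/esym/cvg_lim => //.
rewrite -cvg_shiftS.
have -> : [sequence pseries (fun m => if m is m'.+1 then c m' else 0) x n.+1]_n =
    (fun n => x * pseries c x n).
  apply/funext => n; rewrite /pseries /series /= big_nat_recl// mul0r add0r.
  by rewrite mulr_sumr; apply: eq_bigr => i _; rewrite exprS mulrCA.
exact: cvgMl_tmp.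
Qed.

Lemma psum_sub0_le A c x : (forall m, `|c m.+1| <= A / m.+1`!%:R) -> 0 <= A ->
  `|psum c x - c 0%N| <= A * expR `|x|.
Proof.
move=> cA A0; pose d m := if m is 0 then 0 else c m.
have dA : exp_dominated A d by case=> [|m]//=; rewrite normr0 fact0 divr1.
have -> : psum c x = c 0%N + psum d x.
  have {1}-> : c = (fun m => c 0%N * (m == 0)%:R + 1 * d m).
    by apply/funext => -[|m] /=; rewrite ?mulr0 ?mulr1 ?mul1r ?addr0 ?add0r.
  by rewrite (psum_linear _ _ _ exp_dominated_delta dA) psum_delta mulr1 mul1r.
rewrite addrC addKr; exact: psum_le.
Qed.

End ExpDominatedSeries.

(** * Confluent limit functions and their energy estimate *)

Section ConfluentLimit.
Context {R : realType}.
Implicit Types (c x : R).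

Lemma le_of_derive_le0 (f df : R -> R) (a b : R) : a <= b ->
  (forall x, a <= x <= b -> is_derive x 1 f (df x)) ->
  (forall x, a <= x <= b -> df x <= 0) -> f b <= f a.
Proof.
move=> ab fd df0.
have [||x xab] := @MVT_segment R f df a b ab.
- by move=> x; rewrite in_itv/= => /andP[ax xb]; apply: fd; rewrite !ltW.
- apply: derivable_within_continuous => x; rewrite in_itv/= => /fd.
  by case.
- rewrite in_itv/= in xab; move=> fE; rewrite -subr_le0 fE.
  by rewrite mulr_le0_ge0 ?df0// subr_ge0.
Qed.

Lemma pochhammerSr c m : pochhammer c m.+1 = pochhammer c m * (c + m%:R).
Proof. by rewrite /pochhammer big_ord_recr. Qed.

Lemma pochhammerSl c m : pochhammer c m.+1 = c * pochhammer (c + 1) m.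
Proof.
rewrite /pochhammer big_ord_recl addr0; congr (_ * _).
by apply: eq_bigr => i _; rewrite -addrA -natr1 [1 + _]addrC.
Qed.

Lemma pochhammer_shift c m :
  pochhammer c m * (c + m%:R) = c * pochhammer (c + 1) m.
Proof. by rewrite -pochhammerSr pochhammerSl. Qed.

Lemma pochhammer_gt0 c m : 0 < c -> 0 < pochhammer c m.
Proof. by move=> c0; apply: prodr_gt0 => i _; rewrite ltr_wpDr. Qed.

Lemma pochhammer_ge_half c m : 2^-1 <= c -> 2^-1 <= pochhammer c m.
Proof.
move=> c2; elim: m => [|[|m] IH]; first by rewrite /pochhammer big_ord0; lra.
  by rewrite pochhammerSr /pochhammer big_ord0 mul1r addr0.
rewrite pochhammerSr; apply: le_trans IH _; rewrite ler_peMr//.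
  by rewrite ltW// pochhammer_gt0; lra.
by rewrite -natr1; have := ler0n R m; lra.
Qed.

(** Coefficients of [0F1(; c; - x) = Gamma(c) x^((1 - c) / 2) J_(c - 1)(2 sqrt x)]. *)
Definition bessel c (m : nat) : R := (-1) ^+ m / (m`!%:R * pochhammer c m).

(** The constant is [2] rather than [1] because [(c)_m] can drop to [1/2] when
    [c < 1], as happens in dimension one. *)
Lemma exp_dominated_bessel c : 2^-1 <= c -> exp_dominated 2 (bessel c).
Proof.
move=> c2 m; rewrite /bessel normrM normrX normrN normr1 expr1n mul1r.
have p0 : 0 < pochhammer c m by apply: pochhammer_gt0; lra.
rewrite normfV normrM ger0_norm// (ger0_norm (ltW p0)) invfM mulrC.
apply: ler_pM; rewrite ?invr_ge0 ?(ltW p0)//.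
rewrite -[leRHS]invrK lef_pV2 ?posrE ?invr_gt0//; exact: pochhammer_ge_half.
Qed.

Lemma bessel_diffs c m : 0 < c ->
  pseries_diffs (bessel c) m = - c^-1 * bessel (c + 1) m.
Proof.
move=> c0; rewrite /pseries_diffs /bessel pochhammerSl factS natrM exprS.
have p0 : pochhammer (c + 1) m != 0 by rewrite gt_eqF// pochhammer_gt0; lra.
have f0 : m`!%:R != 0 :> R by rewrite pnatr_eq0 -lt0n fact_gt0.
have m0 : m.+1%:R != 0 :> R by rewrite pnatr_eq0.
by field; rewrite (gt_eqF c0) p0 f0 nat1r m0.
Qed.

Lemma bessel_rec c m : 0 < c ->
  (m%:R + c) * pseries_diffs (bessel c) m = - bessel c m.
Proof.
move=> c0; rewrite /pseries_diffs /bessel pochhammerSr factS natrM exprS.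
have p0 : pochhammer c m != 0 by rewrite gt_eqF// pochhammer_gt0; lra.
have f0 : m`!%:R != 0 :> R by rewrite pnatr_eq0 -lt0n fact_gt0.
have m0 : m.+1%:R != 0 :> R by rewrite pnatr_eq0.
have cm0 : c + m%:R != 0 by rewrite gt_eqF// ltr_wpDr.
by field; rewrite ?nat1r p0 f0 m0 cm0.
Qed.

(** Bessel's equation [x K'' + c K' + K = 0] in the variable [x = z^2 / 4]; it is
    the recursion [bessel_rec] read on the sums. *)
Lemma bessel_ode c x : 2^-1 <= c ->
  let k := bessel c in let d := pseries_diffs k in
  x * psum (pseries_diffs d) x = - c * psum d x - psum k x.
Proof.
move=> c2 k d; have c0 : 0 < c by lra.
have kB := exp_dominated_bessel c2; have dB := exp_dominated_diffs kB.
rewrite (psum_mulX _ (exp_dominated_diffs dB)).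
rewrite -[- psum k x]mulN1r -(psum_linear _ _ _ dB kB); congr psum; apply/funext => -[|m].
  by have := bessel_rec 0 c0; rewrite add0r -/d -/k => E; lra.
by have := bessel_rec m.+1 c0; rewrite /pseries_diffs -/d -/k => E; lra.
Qed.

(** By [bessel_ode] the left-hand side has derivative [(1 - 2 c) K'^2 <= 0], and
    its value at [0] is [1]. *)
Lemma bessel_energy c x : 2^-1 <= c -> 0 <= x ->
  psum (bessel c) x ^+ 2 + x * psum (pseries_diffs (bessel c)) x ^+ 2 <= 1.
Proof.
move=> c2 x0; set k := bessel c; set d := pseries_diffs k.
pose E y := psum k y ^+ 2 + y * psum d y ^+ 2.
have -> : 1 = E 0.
  rewrite /E psum0 mul0r addr0 /k /bessel fact0 /pochhammer big_ord0.
  by rewrite mulr1 divr1 expr1n.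
have kB := exp_dominated_bessel c2; have dB := exp_dominated_diffs kB.
apply: (@le_of_derive_le0 E (fun y => (1 - 2 * c) * psum d y ^+ 2)) => // y.
  move=> _; have dk := is_derive_psum y kB; have dd := is_derive_psum y dB.
  have := bessel_ode y c2; rewrite -/k -/d /= => ode.
  apply: is_derive_eq; rewrite /GRing.scale /= ?expr1 ?mulr1.
  have -> : (1 - 2 * c) * psum d y ^+ 2 = 2 * psum k y * psum d y
    + psum d y ^+ 2 + 2 * psum d y * (- c * psum d y - psum k y) by ring.
  rewrite -ode; ring.
by move=> _; rewrite mulr_le0_ge0 ?sqr_ge0//; lra.
Qed.

Lemma bessel_le1 c x : 2^-1 <= c -> 0 <= x -> `|psum (bessel c) x| <= 1.
Proof.
move=> c2 x0; rewrite -(@ler_pXn2r _ 2)// ?nnegrE// expr1n -normrX.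
rewrite ger0_norm ?sqr_ge0//; apply: le_trans (bessel_energy c2 x0).
by rewrite lerDl mulr_ge0 ?sqr_ge0.
Qed.

(** As [K_c' = - K_(c + 1) / c], the energy bound for [K_c] gives the decay of
    [K_(c + 1)]. *)
Lemma bessel_decay c x : 2^-1 <= c -> 0 < x ->
  `|psum (bessel (c + 1)) x| <= c * x `^ (- 2^-1).
Proof.
move=> c2 x0; have c0 : 0 < c by lra.
have c12 : 2^-1 <= c + 1 by lra.
have B1 := exp_dominated_bessel c12.
have dE : psum (pseries_diffs (bessel c)) x = - c^-1 * psum (bessel (c + 1)) x.
  have -> : pseries_diffs (bessel c) =
      (fun m => - c^-1 * bessel (c + 1) m + 0 * bessel (c + 1) m).
    by apply/funext => m; rewrite bessel_diffs// mul0r addr0.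
  by rewrite (psum_linear _ _ _ B1 B1) mul0r addr0.
have := bessel_energy c2 (ltW x0); rewrite dE.
set K := psum (bessel (c + 1)) x => en.
have {}en : x * (c^-1 * K) ^+ 2 <= 1.
  by apply: le_trans en; rewrite mulNr sqrrN lerDr sqr_ge0.
rewrite -ler_pdivrMl//.
rewrite powRN powR12_sqrt; last exact: ltW.
have s0 : 0 < Num.sqrt x by rewrite sqrtr_gt0.
rewrite -[(Num.sqrt x)^-1]div1r ler_pdivlMr// -(@ler_pXn2r _ 2)// ?nnegrE ?mulr_ge0 ?invr_ge0 ?(ltW c0) ?(ltW s0)//.
rewrite expr1n !exprMn sqr_sqrtr ?(ltW x0)// -normrX ger0_norm ?sqr_ge0//.
by rewrite mulrC -exprMn.
Qed.

End ConfluentLimit.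

(** * Power means of an entire function *)

Section PowerMean.
Context {R : realType}.
Implicit Types (a x B C : R) (h : nat -> R).

(** If [H] has coefficients [h], the sum of [pmean a h] at [x] is
    [a int_0^1 s^(a - 1) H (s x) ds], the mean of [H] between [0] and [x] for the
    probability density proportional to [s^(a - 1)]. *)
Definition pmean a h (m : nat) : R := a / (a + m%:R) * h m.

(** The size of a power mean: it is close to [H 0 = 1] for [x <= 1] and decays
    like [x^(- a)] for [x >= 1], the tail of [H] contributing little for small [a]. *)
Definition cutoff_pow a x : R := Num.max 1 x `^ (- a).

Lemma exp_dominated_pmean a B h : 0 < a ->
  exp_dominated B h -> exp_dominated B (pmean a h).
Proof.
move=> a0 hB; apply: exp_dominated_le => // m.
have am : 0 < a + m%:R by rewrite ltr_wpDr.
by rewrite ger0_norm ?divr_ge0 ?(ltW a0) ?(ltW am)// ler_pdivrMr// mul1r lerDl.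
Qed.

(** The differential form [x F' + a F = a H] of the integral representation. *)
Lemma pmean_ode a B h x : 0 < a -> exp_dominated B h ->
  x * psum (pseries_diffs (pmean a h)) x + a * psum (pmean a h) x = a * psum h x.
Proof.
move=> a0 hB; have mB := exp_dominated_pmean a0 hB.
have dB := exp_dominated_diffs mB.
apply/eqP; rewrite -[eqbRHS](subrK (a * psum (pmean a h) x)) (inj_eq (addIr _)).
rewrite -mulNr -(psum_linear _ _ _ hB mB) (psum_mulX _ dB); apply/eqP.
congr psum; apply/funext => m; rewrite /pmean.
have am : a + m%:R != 0 by rewrite gt_eqF// ltr_wpDr.
case: m am => [|m] am.
  by rewrite addr0 divff ?gt_eqF// mul1r mulNr subrr.
by rewrite /pseries_diffs; field; rewrite nat1r.
Qed.

Lemma pmean_sub1_le a B h x : 0 < a -> exp_dominated B h -> h 0%N = 1 ->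
  `|psum (pmean a h) x - 1| <= a * B * expR `|x|.
Proof.
move=> a0 hB h0; have B0 := exp_dominated_ge0 hB.
have -> : 1 = pmean a h 0 by rewrite /pmean h0 addr0 divff ?gt_eqF// mulr1.
apply: psum_sub0_le => [m|]; last by rewrite mulr_ge0 // ltW.
rewrite /pmean normrM -mulrA; apply: ler_pM => //.
have am : 1 <= a + m.+1%:R by rewrite -natr1; have := ler0n R m; lra.
have am0 : 0 < a + m.+1%:R by lra.
rewrite ger0_norm ?divr_ge0 ?(ltW a0) ?(ltW am0)// ler_pdivrMr//.
by rewrite ler_peMr // ltW.
Qed.

(** By [pmean_ode], [x^a F] has derivative [a x^(a - 1) H = O (a x^(- 5/4))] for
    [a <= 1/4], whose integral from [1] to infinity is [O (a)]. *)
Lemma pmean_tail a B C h x : 0 < a <= 4^-1 -> exp_dominated B h ->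
  (forall y, 1 <= y -> `|psum h y| <= C * y `^ (- 2^-1)) -> 1 <= x ->
  `|x `^ a * psum (pmean a h) x - psum (pmean a h) 1| <= a * (4 * C).
Proof.
move=> /andP[a0 a4] hB hC x1; have mB := exp_dominated_pmean a0 hB.
have C0 : 0 <= C.
  have := hC 1 (lexx _); rewrite powR1 mulr1; exact: le_trans.
pose F := psum (pmean a h).
(* [g] is the integral of the bound [a C s^(- 5/4)] from [y] to infinity, so both
   [f + g] and [- f + g] are nonincreasing *)
pose f y := y `^ a * F y; pose g y : R := a * (4 * C) * y `^ (- 4^-1).
have g1 : g 1 = a * (4 * C) by rewrite /g powR1 mulr1.
have f1 : f 1 = F 1 by rewrite /f powR1 mul1r.
have gx : 0 <= g x by rewrite !mulr_ge0 ?powR_ge0 // ltW.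
pose dg y := - (a * C * y `^ (- 4^-1 - 1)) : R.
pose df y := a * psum h y * y `^ (a - 1).
have dgE (y : R) : 1 <= y -> is_derive y 1 g (dg y).
  move=> y1; have y0 : 0 < y by lra.
  have dp := is_derive1_powR (- 4^-1) y0.
  by apply: is_derive_eq; rewrite /GRing.scale /= /dg; field.
have dfE (y : R) : 1 <= y -> is_derive y 1 f (df y).
  move=> y1; have y0 : 0 < y by lra.
  have dp := is_derive1_powR a y0; have dF := is_derive_psum y mB.
  apply: is_derive_eq; rewrite /GRing.scale /= /df -(pmean_ode _ a0 hB) -/F.
  have -> : y `^ a = y * y `^ (a - 1) by rewrite mulr_powRB1 // ltW.
  by ring.
have dfg (y : R) : 1 <= y -> `|df y| <= - dg y.
  move=> y1; have y0 : 0 < y by lra.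
  rewrite /df /dg opprK normrM (ger0_norm (powR_ge0 _ _)) normrM gtr0_norm//.
  rewrite -!mulrA ler_wpM2l ?(ltW a0)//.
  apply: le_trans (ler_wpM2r (powR_ge0 _ _) (hC _ y1)) _.
  rewrite -mulrA ler_wpM2l// -powRD; last by apply/implyP => _; rewrite gt_eqF.
  by rewrite ler_powR//; lra.
have U : f x + g x <= f 1 + g 1.
  apply: (@le_of_derive_le0 R (f + g) (fun y => df y + dg y)) => //.
    by move=> y /andP[y1 _]; have d1 := dfE y y1; have d2 := dgE y y1; exact: is_deriveD.
  by move=> y /andP[y1 _]; have := dfg y y1; have := ler_norm (df y); lra.
have L : - f x + g x <= - f 1 + g 1.
  apply: (@le_of_derive_le0 R (- f + g) (fun y => - df y + dg y)) => //.
    by move=> y /andP[y1 _]; have d1 := dfE y y1; have d2 := dgE y y1;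
      apply: is_deriveD.
  by move=> y /andP[y1 _]; have := dfg y y1; have := ler_norm (- df y); rewrite normrN; lra.
by rewrite -/(F 1) -/(F x) -/(f x) -f1 -g1 ler_norml; apply/andP; split; lra.
Qed.

Lemma pmean_cutoff_pow a B C h x : 0 < a <= 4^-1 -> exp_dominated B h ->
  h 0%N = 1 ->
  (forall y, 1 <= y -> `|psum h y| <= C * y `^ (- 2^-1)) -> 0 <= x ->
  `|psum (pmean a h) x - cutoff_pow a x|
    <= a * (B * expR 1 + 4 * C) * cutoff_pow a x.
Proof.
move=> a04 hB h0 hC x0; have /andP[a0 a4] := a04; rewrite /cutoff_pow.
have B0 := exp_dominated_ge0 hB.
have C0 : 0 <= C.
  have := hC 1 (lexx _); rewrite powR1 mulr1; exact: le_trans.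
have near0 y : 0 <= y <= 1 -> `|psum (pmean a h) y - 1| <= a * (B * expR 1).
  move=> /andP[y0 y1]; apply: le_trans (pmean_sub1_le _ a0 hB h0) _.
  by rewrite -mulrA ler_wpM2l ?(ltW a0)// ler_wpM2l// ler_expR ger0_norm.
have [x1|x1] := leP x 1.
  rewrite powR1 mulr1; apply: le_trans (near0 x _) _; first by rewrite x0.
  by rewrite ler_wpM2l ?(ltW a0)// lerDl mulr_ge0.
have xp : 0 < x by lra.
have p0 : 0 < x `^ a by rewrite powR_gt0.
have n1 := near0 1; have := pmean_tail a04 hB hC (ltW x1).
have {n1}:= n1 _; rewrite ler01 lexx => /(_ isT).
set F := psum _ x; set F1 := psum _ 1 => H1 H2.
rewrite powRN ler_pdivlMr// -[X in _ * X](gtr0_norm p0) -normrM.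
rewrite mulrBl mulVf ?gt_eqF// mulrC.
have -> : x `^ a * F - 1 = (x `^ a * F - F1) + (F1 - 1) by ring.
apply: le_trans (ler_normD _ _) _; rewrite [_ + 4 * C]addrC mulrDr.
exact: lerD.
Qed.

End PowerMean.

(** * The hypergeometric functions of the multipliers *)

Section Hypergeometric.
Context {R : realType}.
Implicit Types (a c x y B C : R) (h : nat -> R).

Lemma pochhammer_ratio c m : 0 < c ->
  pochhammer c m / pochhammer (c + 1) m = c / (c + m%:R).
Proof.
move=> c0; have p0 : pochhammer (c + 1) m != 0.
  by rewrite gt_eqF// pochhammer_gt0//; lra.
have cm : c + m%:R != 0 by rewrite gt_eqF// ltr_wpDr.
by apply/eqP; rewrite eqr_div// pochhammer_shift.
Qed.

(** Coefficients of [1F2(1; 2, c + 1; - x) = c (1 - K_c x) / x]; its power means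
    give [lambda2]. *)
Definition shear_coef c (m : nat) : R := bessel (c + 1) m / m.+1%:R.

(** Coefficients of [2F3(1, 5/2; 2, 3/2, c + 1; - x)]: since
    [(5/2)_m / (3/2)_m = 1 + 2 m / 3 = (2 (m + 1) + 1) / 3], this function is the
    combination [2/3 K_(c + 1) + 1/3 1F2(1; 2, c + 1; - x)].  Its power means give
    the first term of [lambda1]. *)
Definition dilation_coef c (m : nat) : R :=
  2 / 3 * bessel (c + 1) m + 1 / 3 * shear_coef c m.

Lemma pFq_psum (us ls : seq R) h y :
  (forall m, (\prod_(c <- us) pochhammer c m) / (\prod_(c <- ls) pochhammer c m)
     * ((-1) ^+ m / m`!%:R) = h m) ->
  pFq us ls (- y) = psum h y.
Proof.
move=> E; rewrite /pFq /psum /pseries; congr (limn (series _)).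
by apply/funext => m; rewrite /= -E (exprNn y); ring.
Qed.

Lemma pFq_bessel a c y : 0 < a -> 0 < c ->
  pFq [:: a] [:: c; a + 1] (- y) = psum (pmean a (bessel c)) y.
Proof.
move=> a0 c0; apply: pFq_psum => m; rewrite !big_cons !big_nil !mulr1.
by rewrite /pmean -pochhammer_ratio// /bessel !invfM; ring.
Qed.

Lemma pFq_shear a c y : 0 < a -> 0 < c ->
  pFq [:: 1; a] [:: 2; c + 1; a + 1] (- y) = psum (pmean a (shear_coef c)) y.
Proof.
move=> a0 c0; apply: pFq_psum => m; rewrite !big_cons !big_nil !mulr1.
rewrite /pmean -pochhammer_ratio// /shear_coef /bessel -[m.+1%:R]nat1r.
by rewrite -[(1 + m%:R)^-1]div1r -pochhammer_ratio// !invfM; ring.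
Qed.

Lemma pFq_dilation a c y : 0 < a -> 0 < c ->
  pFq [:: 1; 5 / 2; a] [:: 2; 3 / 2; c + 1; a + 1] (- y) =
  psum (pmean a (dilation_coef c)) y.
Proof.
move=> a0 c0; apply: pFq_psum => m; rewrite !big_cons !big_nil !mulr1.
rewrite /pmean -pochhammer_ratio// /dilation_coef /shear_coef /bessel -[m.+1%:R]nat1r.
have h3 : 0 < 3 / 2 :> R by lra.
have := pochhammer_ratio m h3; have -> : 3 / 2 + 1 = 5 / 2 :> R by lra.
have m32 : 3 / 2 + m%:R != 0 :> R by rewrite gt_eqF// ltr_wpDr.
have m1 : 1 + m%:R != 0 :> R by rewrite gt_eqF// ltr_wpDr.
move=> /(congr1 GRing.inv); rewrite !invf_div => E.
have E1 := pochhammer_ratio m (@ltr01 R).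
rewrite !invfM; transitivity ((pochhammer 1 m / pochhammer (1 + 1) m) *
   (pochhammer (5 / 2) m / pochhammer (3 / 2) m) *
   (pochhammer a m / pochhammer (a + 1) m) * ((pochhammer (c + 1) m)^-1 *
   ((-1) ^+ m / m`!%:R))); first by ring.
rewrite E1 E.
have f0 : m`!%:R != 0 :> R by rewrite pnatr_eq0 -lt0n fact_gt0.
have p1 : pochhammer (a + 1) m != 0 by rewrite gt_eqF// pochhammer_gt0//; lra.
have p2 : pochhammer (c + 1) m != 0 by rewrite gt_eqF// pochhammer_gt0//; lra.
by field; rewrite m1 p1 p2 f0.
Qed.

(** The hypotheses under which a power mean is controlled by [cutoff_pow]. *)
Definition sqrt_decay B C h :=
  [/\ exp_dominated B h, h 0%N = 1 &
      forall y, 1 <= y -> `|psum h y| <= C * y `^ (- 2^-1)].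

Lemma bessel0 c : bessel c 0 = 1.
Proof. by rewrite /bessel fact0 /pochhammer big_ord0 mulr1 divr1. Qed.

Lemma sqrt_decay_bessel c : 2^-1 <= c -> sqrt_decay 2 c (bessel (c + 1)).
Proof.
move=> c2; split; [apply: exp_dominated_bessel; lra|exact: bessel0|].
by move=> y y1; apply: bessel_decay => //; lra.
Qed.

Lemma exp_dominated_shear c : 2^-1 <= c -> exp_dominated 2 (shear_coef c).
Proof.
move=> c2; have c12 : 2^-1 <= c + 1 by lra.
have -> : shear_coef c = (fun m => m.+1%:R^-1 * bessel (c + 1) m).
  by apply/funext => m; rewrite /shear_coef mulrC.
apply: exp_dominated_le => [|m]; first exact: exp_dominated_bessel.
by rewrite ger0_norm ?invr_ge0// invf_le1// ler1n.
Qed.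

(** Multiplying by [x] turns the bound [|K_c| <= 1] into decay of order [1 / x]. *)
Lemma mulX_shear c x : 2^-1 <= c ->
  x * psum (shear_coef c) x = c * (1 - psum (bessel c) x).
Proof.
move=> c2; rewrite (psum_mulX _ (exp_dominated_shear c2)).
have -> : c * (1 - psum (bessel c) x) = c * 1 + - c * psum (bessel c) x by ring.
rewrite -(psum_delta x) -(psum_linear _ _ _ exp_dominated_delta (exp_dominated_bessel c2)).
congr psum; apply/funext => -[|m]; first by rewrite eqxx bessel0 !mulr1 subrr.
rewrite /= mulr0 add0r /shear_coef /bessel pochhammerSl factS natrM exprS.
have p2 : pochhammer (c + 1) m != 0 by rewrite gt_eqF// pochhammer_gt0//; lra.
have f0 : m`!%:R != 0 :> R by rewrite pnatr_eq0 -lt0n fact_gt0.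
have m0 : m.+1%:R != 0 :> R by rewrite pnatr_eq0.
have c0 : c != 0 by rewrite gt_eqF//; lra.
by field; rewrite c0 p2 f0 nat1r m0.
Qed.

Lemma sqrt_decay_shear c : 2^-1 <= c -> sqrt_decay 2 (2 * c) (shear_coef c).
Proof.
move=> c2; split; first exact: exp_dominated_shear.
  by rewrite /shear_coef bessel0 divr1.
move=> y y1; have y0 : 0 < y by lra.
rewrite -(ler_pM2l y0) -{1}(gtr0_norm y0) -normrM mulX_shear// normrM gtr0_norm; last by lra.
have := bessel_le1 c2 (ltW y0); have := ler_normB 1 (psum (bessel c) y).
rewrite normr1 => H1 H2.
have y2 : 1 <= y * y `^ (- 2^-1).
  have -> : - 2^-1 = 2^-1 - 1 :> R by lra.
  by rewrite mulr_powRB1 ?(ltW y0)// -[leLHS](powRr0 y) ler_powR.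
have -> : y * (2 * c * y `^ (- 2^-1)) = c * (2 * (y * y `^ (- 2^-1))) by ring.
by rewrite ler_wpM2l//; lra.
Qed.

Lemma sqrt_decay_dilation c : 2^-1 <= c ->
  sqrt_decay 2 (2 * c) (dilation_coef c).
Proof.
move=> c2; have c12 : 2^-1 <= c + 1 by lra.
have [kB k0 kC] := sqrt_decay_bessel c2; have [hB h0 hC] := sqrt_decay_shear c2.
have n23 : `|2 / 3 : R| = 2 / 3 by apply: ger0_norm; lra.
have n13 : `|1 / 3 : R| = 1 / 3 by apply: ger0_norm; lra.
split.
- move=> m; apply: le_trans (ler_normD _ _) _.
  rewrite (normrM (2 / 3)) (normrM (1 / 3)) n23 n13.
  by have := kB m; have := hB m; lra.
- by rewrite /dilation_coef k0 h0; lra.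
move=> y y1; rewrite (psum_linear _ _ _ kB hB).
apply: le_trans (ler_normD _ _) _.
rewrite (normrM (2 / 3)) (normrM (1 / 3)) n23 n13.
have := kC y y1; have := hC y y1; have : 0 <= c * y `^ (- 2^-1).
  by rewrite mulr_ge0 ?powR_ge0//; lra.
lra.
Qed.

End Hypergeometric.

(** * The peridynamic multipliers *)

(** The unperturbed value of the first combination is [tau] times
    [3 mu + (lam - mu) tau = 3 mu (1 - tau) + (lam + 2 mu) tau], a convex
    combination of two numbers that are at least [m]; the smallness of [q] leaves
    half of it. *)
Lemma cutoff_perturbation {R : realType} (mu lam m tau q F1 F2 G : R) :
  0 < mu -> m <= mu -> m <= lam + 2 * mu -> 0 < tau <= 1 -> 0 < q <= 1 ->
  q * (3 * mu + 3 * `|lam - mu|) <= m / 2 ->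
  `|F1 - tau| <= q * tau -> `|F2 - tau| <= q * tau -> `|G - tau| <= q * tau ->
  m / 2 * tau <= 3 * mu * F1 + (lam - mu) * G ^+ 2 /\ m / 2 * tau <= mu * F2.
Proof.
move=> mu_gt0 mmu mlam /andP[t0 t1] /andP[q0 q1] qE.
rewrite !ler_norml => /andP[F1l _] /andP[F2l _] /andP[Gl Gu].
have {}qE : tau * (q * (3 * mu + 3 * `|lam - mu|)) <= tau * (m / 2).
  by rewrite ler_pM2l.
have mt : tau * m <= tau * mu by rewrite ler_pM2l.
have qt0 : 0 < q * tau by rewrite mulr_gt0.
have qmu0 : 0 < q * tau * mu by rewrite mulr_gt0.
have qlam0 : 0 <= q * tau * `|lam - mu| by rewrite mulr_ge0// ltW.
split; last first.
  have H : mu * (tau - q * tau) <= mu * F2 by rewrite ler_pM2l//; clear -F2l; lra.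
  clear -qE mt H qmu0 qlam0; lra.
have F1' : mu * (tau - q * tau) <= mu * F1 by rewrite ler_pM2l//; clear -F1l; lra.
have G2 : `|G ^+ 2 - tau ^+ 2| <= q * tau * 3.
  rewrite subr_sqr normrM; apply: ler_pM => //; first by rewrite ler_norml Gl.
  have qt : q * tau <= 1 by apply: mulr_ile1 => //; exact: ltW.
  clear -Gl Gu t0 t1 qt0 qt; rewrite ler_norml; apply/andP; split; lra.
have LG : (lam - mu) * tau ^+ 2 - `|lam - mu| * (q * tau * 3) <= (lam - mu) * G ^+ 2.
  have := ler_wpM2l (normr_ge0 (lam - mu)) G2; rewrite -normrM.
  have := ler_norm (- ((lam - mu) * (G ^+ 2 - tau ^+ 2))); rewrite normrN.
  move: `|(lam - mu) * _| => r; clear; lra.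
have M : tau * m <= tau * (3 * mu * (1 - tau) + (lam + 2 * mu) * tau).
  rewrite ler_pM2l//.
  have K1 : m * (1 - tau) <= mu * (1 - tau) by rewrite ler_wpM2r// subr_ge0.
  have K2 : m * tau <= (lam + 2 * mu) * tau by rewrite ler_wpM2r// ltW.
  have K3 : 0 <= mu * (1 - tau) by rewrite mulr_ge0 ?subr_ge0// ltW.
  clear -K1 K2 K3; lra.
clear -qE F1' LG M qmu0 qlam0; lra.
Qed.

Section Multipliers.
Context {R : realType} (n : nat) (n_ge1 : (1 <= n)%N).
Variables (mu lam delta : R).
Hypotheses (mu_gt0 : 0 < mu) (lam_mu_gt0 : 0 < lam + 2 * mu).
Implicit Types (beta : R) (v : 'cV[R]_n).

Let c : R := (n%:R + 2) / 2.

Definition gap beta : R := (n%:R + 2 - beta) / 2.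

Definition scaled_sqnorm v : R := sqnorm v * delta ^+ 2 / 4.

Lemma sqnorm_ge0 v : 0 <= sqnorm v.
Proof. by apply: sumr_ge0 => i _; exact: sqr_ge0. Qed.

Lemma scaled_sqnorm_ge0 v : 0 <= scaled_sqnorm v.
Proof. by rewrite divr_ge0// mulr_ge0 ?sqnorm_ge0 ?sqr_ge0. Qed.

Lemma lambda1_pmean beta v : beta < n%:R + 2 ->
  lambda1 mu lam delta beta v = - sqnorm v *
    (3 * mu * psum (pmean (gap beta) (dilation_coef c)) (scaled_sqnorm v) +
     (lam - mu) * psum (pmean (gap beta) (bessel c)) (scaled_sqnorm v) ^+ 2).
Proof.
move=> bn; have a0 : 0 < gap beta by rewrite /gap; lra.
have c0 : 0 < c by rewrite /c; have := ler0n R n; lra.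
rewrite -pFq_bessel// -pFq_dilation// /lambda1 -/c.
have -> : (n%:R + 4) / 2 = c + 1 :> R by rewrite /c; lra.
have -> : (n%:R + 4 - beta) / 2 = gap beta + 1 by rewrite /gap; lra.
have -> : - (1 / 4) * sqnorm v * delta ^+ 2 = - scaled_sqnorm v.
  by rewrite /scaled_sqnorm; field.
by [].
Qed.

Lemma lambda2_pmean beta v : beta < n%:R + 2 ->
  lambda2 mu delta beta v =
    - mu * sqnorm v * psum (pmean (gap beta) (shear_coef c)) (scaled_sqnorm v).
Proof.
move=> bn; have a0 : 0 < gap beta by rewrite /gap; lra.
have c0 : 0 < c by rewrite /c; have := ler0n R n; lra.
rewrite -pFq_shear// /lambda2.
have -> : (n%:R + 4) / 2 = c + 1 :> R by rewrite /c; lra.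
have -> : (n%:R + 4 - beta) / 2 = gap beta + 1 by rewrite /gap; lra.
have -> : - (1 / 4) * sqnorm v * delta ^+ 2 = - scaled_sqnorm v.
  by rewrite /scaled_sqnorm; field.
by [].
Qed.

Let c_half : 2^-1 <= c.
Proof. by rewrite /c; have := ler0n R n; lra. Qed.

(** Here [c = n / 2 + 1], so [bessel_decay] is applied with the parameter
    [n / 2 >= 1/2]; this is where the dimension must be positive. *)
Lemma sqrt_decay_bessel_dim : sqrt_decay 2 (2 * c) (bessel c).
Proof.
have n1 : 1 <= n%:R :> R by rewrite ler1n.
have c1 : 2^-1 <= c - 1 by rewrite /c; lra.
have [] := sqrt_decay_bessel c1; rewrite subrK => kB k0 kC; split=> // y y1.
apply: le_trans (kC y y1) _; rewrite ler_wpM2r ?powR_ge0//.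
by have := c_half; lra.
Qed.

Lemma gap_cvg0 : gap beta @[beta --> (n%:R + 2 : R)^'-] --> (0 : R).
Proof.
apply: cvg_at_left_filter.
have -> : (0 : R) = (n%:R + 2 - (n%:R + 2)) / 2 by rewrite subrr mul0r.
apply: cvgMr_tmp; apply: cvgB; [exact: cvg_cst|exact: cvg_id].
Qed.

Lemma gap_gt0_near : \forall beta \near (n%:R + 2 : R)^'-, 0 < gap beta.
Proof.
near=> beta; rewrite /gap divr_gt0// subr_gt0.
by near: beta; exact: nbhs_left_lt.
Unshelve. all: by end_near. Qed.

Lemma pmean_cvg1 B h y : exp_dominated B h -> h 0%N = 1 ->
  psum (pmean (gap beta) h) y @[beta --> (n%:R + 2 : R)^'-] --> (1 : R).
Proof.
move=> hB h0; pose u beta := gap beta * (B * expR `|y|).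
have u0 : u beta @[beta --> (n%:R + 2 : R)^'-] --> (0 : R).
  rewrite -[X in _ --> X](mul0r (B * expR `|y|)); apply: cvgMr_tmp; exact: gap_cvg0.
apply: (@squeeze_cvgr _ _ _ _ (fun beta => 1 - u beta) (fun beta => 1 + u beta)).
- near=> beta; rewrite -ler_distl /u mulrA; apply: pmean_sub1_le => //.
  by near: beta; exact: gap_gt0_near.
- by rewrite -[X in _ --> X]subr0; apply: cvgB => //; exact: cvg_cst.
- by rewrite -[X in _ --> X]addr0; apply: cvgD => //; exact: cvg_cst.
Unshelve. all: by end_near. Qed.

Lemma lambda1_cvg v :
  lambda1 mu lam delta beta v @[beta --> (n%:R + 2 : R)^'-]
    --> - (lam + 2 * mu) * sqnorm v.
Proof.
have [dB d0 _] := sqrt_decay_dilation c_half.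
have [kB k0 _] := sqrt_decay_bessel_dim.
have -> : - (lam + 2 * mu) * sqnorm v =
  - sqnorm v * (3 * mu * 1 + (lam - mu) * (1 * 1)) by ring.
have E : \forall beta \near (n%:R + 2 : R)^'-, - sqnorm v *
    (3 * mu * psum (pmean (gap beta) (dilation_coef c)) (scaled_sqnorm v) +
     (lam - mu) * (psum (pmean (gap beta) (bessel c)) (scaled_sqnorm v) *
       psum (pmean (gap beta) (bessel c)) (scaled_sqnorm v))) =
     lambda1 mu lam delta beta v.
  near=> beta; have bn : beta < n%:R + 2 by near: beta; exact: nbhs_left_lt.
  by rewrite lambda1_pmean// expr2.
apply: cvg_trans (near_eq_cvg E) _.
apply: cvgMl_tmp; apply: cvgD; apply: cvgMl_tmp.
  exact: pmean_cvg1 dB d0.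
by apply: cvgM; exact: pmean_cvg1 kB k0.
Unshelve. all: by end_near. Qed.

Lemma lambda2_cvg v :
  lambda2 mu delta beta v @[beta --> (n%:R + 2 : R)^'-] --> - mu * sqnorm v.
Proof.
have [hB h0 _] := sqrt_decay_shear c_half.
rewrite -[X in _ --> X]mulr1.
have E : \forall beta \near (n%:R + 2 : R)^'-, - mu * sqnorm v *
    psum (pmean (gap beta) (shear_coef c)) (scaled_sqnorm v) =
    lambda2 mu delta beta v.
  near=> beta; have bn : beta < n%:R + 2 by near: beta; exact: nbhs_left_lt.
  by rewrite lambda2_pmean.
apply: cvg_trans (near_eq_cvg E) _.
by apply: cvgMl_tmp; exact: pmean_cvg1 hB h0.
Unshelve. all: by end_near. Qed.

Lemma cutoff_pow_gt0 (a x : R) : 0 < cutoff_pow a x.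
Proof. by rewrite powR_gt0// lt_max ltr01. Qed.

Lemma cutoff_pow_le1 (a x : R) : 0 <= a -> cutoff_pow a x <= 1.
Proof.
move=> a0; rewrite /cutoff_pow -[leRHS](powRr0 (Num.max 1 x)) ler_powR//.
  by rewrite le_max lexx.
by rewrite oppr_le0.
Qed.

(** All three power means equal [tau] up to the same relative error, which is
    [O (gap beta)] uniformly in [v]. *)
Lemma lambda_cutoff : exists2 m : R, 0 < m &
  \forall beta \near (n%:R + 2 : R)^'-, forall v,
    let tau := cutoff_pow (gap beta) (scaled_sqnorm v) in
    m * (sqnorm v * tau) <= - lambda1 mu lam delta beta v /\
    m * (sqnorm v * tau) <= - lambda2 mu delta beta v.
Proof.
pose m0 := Num.min mu (lam + 2 * mu).
have m0_gt0 : 0 < m0 by rewrite lt_min mu_gt0.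
have m0mu : m0 <= mu by rewrite ge_min lexx.
have m0lam : m0 <= lam + 2 * mu by rewrite ge_min lexx orbT.
pose D := 2 * expR 1 + 4 * (2 * c) : R.
have D0 : 0 < D by rewrite addr_gt0 ?mulr_gt0 ?expR_gt0//; have := c_half; lra.
(* [q * E] bounds the effect of the relative errors on either multiplier *)
pose E := 3 * mu + 3 * `|lam - mu|.
have E0 : 0 < E by rewrite /E; have := normr_ge0 (lam - mu); lra.
have small (e : R) : 0 < e -> \forall beta \near (n%:R + 2 : R)^'-, gap beta <= e.
  by move=> e0; apply: cvgr_le gap_cvg0 _ e0.
exists (m0 / 2); first by rewrite divr_gt0.
near=> beta => v.
have bn : beta < n%:R + 2 by near: beta; exact: nbhs_left_lt.
rewrite lambda1_pmean// lambda2_pmean//.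
set y := scaled_sqnorm v; set tau := cutoff_pow _ y.
have a0 : 0 < gap beta by near: beta; exact: gap_gt0_near.
have a4 : gap beta <= 4^-1 by near: beta; apply: small; lra.
have aD : gap beta * D <= 1.
  by rewrite -ler_pdivlMr// div1r; near: beta; apply: small; rewrite invr_gt0.
have aDE : gap beta * D * E <= m0 / 2.
  rewrite -mulrA -ler_pdivlMr ?mulr_gt0//.
  by near: beta; apply: small; rewrite !divr_gt0 ?mulr_gt0.
have y0 : 0 <= y := scaled_sqnorm_ge0 v.
have t0 : 0 < tau := cutoff_pow_gt0 _ _.
have t1 : tau <= 1 := cutoff_pow_le1 _ (ltW a0).
have approx h : sqrt_decay 2 (2 * c) h ->
    `|psum (pmean (gap beta) h) y - tau| <= gap beta * D * tau.
  by move=> [hB h0 hC]; apply: pmean_cutoff_pow => //; rewrite a0.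
have := approx _ (sqrt_decay_dilation c_half).
have := approx _ sqrt_decay_bessel_dim.
have := approx _ (sqrt_decay_shear c_half).
set F2 := psum _ y; set G := psum _ y; set F1 := psum _ y.
move=> F2t Gt F1t; have q0 : 0 < gap beta * D by rewrite mulr_gt0.
have [] := @cutoff_perturbation R mu lam m0 tau (gap beta * D) F1 F2 G; rewrite ?t0 ?q0//.
move: (sqnorm v) (sqnorm_ge0 v) => s s0 /(ler_wpM2l s0) L1 /(ler_wpM2l s0) L2.
rewrite !mulNr !opprK mulrCA L1; split=> //.
by rewrite [leRHS]mulrAC [leRHS]mulrC.
Unshelve. all: by end_near. Qed.

(** The power mean costs a factor [|v|^(- 2 a)] only, which the loss [e] absorbs;
    the constant accounts for the passage from [|v|^2 delta^2 / 4] to [1 + |v|^2]. *)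
Lemma sqnorm_cutoff_ge (e a : R) v : 0 < a <= e -> e < 1 -> 1 <= sqnorm v ->
  (2 * Num.max 1 (delta ^+ 2 / 4))^-1 * (1 + sqnorm v) `^ (1 - e) <=
  sqnorm v * cutoff_pow a (scaled_sqnorm v).
Proof.
move=> /andP[a0 ae] e1 s1; set s := sqnorm v in s1 *; set d := Num.max 1 _.
have d1 : 1 <= d by rewrite le_max lexx.
have ds1 : 1 <= d * (1 + s) by rewrite -[leLHS]mulr1 ler_pM//; lra.
have H : d^-1 * (1 + s) `^ (- e) <= cutoff_pow a (scaled_sqnorm v).
  have : (d * (1 + s)) `^ (- e) <= cutoff_pow a (scaled_sqnorm v).
    apply: (@le_trans _ _ ((d * (1 + s)) `^ (- a))).
      by rewrite ler_powR// lerN2.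
    have mx0 : 0 < Num.max 1 (scaled_sqnorm v) by rewrite lt_max ltr01.
    have ds0 : 0 < d * (1 + s) by lra.
    rewrite /cutoff_pow !powRN lef_pV2 ?posrE ?powR_gt0//.
    rewrite ge0_ler_powR ?nnegrE ?(ltW a0) ?(ltW mx0) ?(ltW ds0)//.
    rewrite ge_max ds1 /= /scaled_sqnorm -/s -mulrA mulrC.
    apply: ler_pM; rewrite ?divr_ge0 ?sqr_ge0//; [lra| |lra].
    by rewrite le_max lexx orbT.
  apply: le_trans; rewrite powRM; [|lra|lra].
  rewrite ler_wpM2r ?powR_ge0// -powR_inv1; last by lra.
  by rewrite ler_powR//; lra.
have -> : (1 + s) `^ (1 - e) = (1 + s) * (1 + s) `^ (- e).
  rewrite -(@mulr_powRB1 _ (1 + s) (1 - e)); [|lra|lra].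
  by congr (_ * _ `^ _); ring.
rewrite invfM mulrACA; apply: ler_pM => //.
- by rewrite mulr_ge0 ?invr_ge0//; lra.
- by rewrite mulr_ge0 ?invr_ge0 ?powR_ge0//; lra.
by lra.
Qed.

End Multipliers.

(** * Uniqueness for the mode-by-mode linear equation *)

Section Uniqueness.
Context {R : realType}.

(** The real counterpart of [time_derivative]: two-sided for [t > 0], from the
    right at [t = 0]. *)
Definition onesided_derivative (f g : R -> R) := forall t : R, 0 <= t ->
  h^-1 * (f (t + h) - f t) @[h --> within [set h | 0 <= t + h] 0^'] --> g t.

Lemma onesided_is_derive (f g : R -> R) (t : R) : onesided_derivative f g ->
  0 < t -> is_derive t 1 f (g t).
Proof.
move=> fg t0.
have cf : h^-1 * (f (t + h) - f t) @[h --> 0^'] --> g t.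
  move=> P /(fg t (ltW t0)) HP.
  have D0 : \forall h \near 0^', 0 <= t + h.
    apply: nbhs_dnbhs; near=> h.
    have : - t < h by near: h; apply: lt_nbhsr; rewrite oppr_lt0.
    by lra.
  by move: D0 HP; apply: filterS2 => h Dh Hh; exact: Hh.
have E : (fun h => h^-1 *: ((f \o shift t) (h *: 1) - f t)) =
    (fun h => h^-1 * (f (t + h) - f t)).
  by apply/funext => h /=; rewrite [h *: 1]mulr1 (addrC h).
split; first by rewrite /derivable E; apply/cvg_ex; exists (g t).
by rewrite /derive E; apply: cvg_lim.
Unshelve. all: by end_near. Qed.

Lemma onesided_right_cvg (f g : R -> R) : onesided_derivative f g ->
  f h @[h --> 0^'+] --> f 0.
Proof.
move=> /(_ 0 (lexx 0)) fg.
have {}fg : h^-1 * (f (0 + h) - f 0) @[h --> 0^'+] --> g 0.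
  move=> P /fg HP; rewrite /at_right /fmap /within /=.
  move: (HP : nbhs (0 : R) (fun h : R => h != 0 -> 0 <= 0 + h -> _)).
  apply: filterS => h Hh h0.
  by apply: Hh; [rewrite gt_eqF|rewrite add0r ltW].
have E : \forall h \near 0^'+, h * (h^-1 * (f (0 + h) - f 0)) + f 0 = f h.
  near=> h; have h0 : 0 < h by near: h; exact: nbhs_right_gt.
  by rewrite mulrA divff ?gt_eqF// mul1r subrK add0r.
have : h * (h^-1 * (f (0 + h) - f 0)) + f 0 @[h --> 0^'+] --> 0 * g 0 + f 0.
  apply: cvgD; last exact: cvg_cst.
  by apply: cvgM => //; apply: cvg_at_right_filter; exact: cvg_id.
by rewrite mul0r add0r; exact: cvg_trans (near_eq_cvg E).
Unshelve. all: by end_near. Qed.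

(** Gronwall's argument: [E = sum_i (w_i^2 + z_i^2)] satisfies [E' <= C E] with
    [C = 1 + 2 sum_(i, j) |A_ij|], hence [E exp (- C t)] is nonincreasing.  It is
    continuous up to [t = 0], where it vanishes, so it is zero. *)
Lemma linear_ode_unique (m : nat) (A : 'M[R]_m) (w z : 'I_m -> R -> R) :
  (forall i, w i 0 = 0) -> (forall i, z i 0 = 0) ->
  (forall i, onesided_derivative (w i) (z i)) ->
  (forall i, onesided_derivative (z i) (fun t => \sum_j A i j * w j t)) ->
  forall t : R, 0 <= t -> forall i, w i t = 0.
Proof.
move=> w0 z0 dw dz t; rewrite le_eqVlt => /predU1P[<- //|t0].
pose E := \sum_i (w i ^+ 2 + z i ^+ 2) : R -> R.
pose C := 1 + 2 * \sum_i \sum_j `|A i j|.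
have EE s : E s = \sum_i (w i s ^+ 2 + z i s ^+ 2).
  by rewrite /E fct_sumE.
have e0 i s : 0 <= w i s ^+ 2 + z i s ^+ 2 by rewrite addr_ge0 ?sqr_ge0.
have leE i s : w i s ^+ 2 + z i s ^+ 2 <= E s.
  by rewrite EE (bigD1 i)//= lerDl sumr_ge0.
pose dE s := \sum_i (2 * w i s * z i s + 2 * z i s * \sum_j A i j * w j s).
have dEE (s : R) : 0 < s -> is_derive s 1 E (dE s).
  move=> s0; suff H i : is_derive s 1 (w i ^+ 2 + z i ^+ 2)
      (2 * w i s * z i s + 2 * z i s * \sum_j A i j * w j s).
    exact: (is_derive_sum H).
  have dwi := onesided_is_derive (dw i) s0.
  move: (onesided_is_derive (dz i) s0); move: (\sum_j _) => r dzi.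
  apply: (is_derive_eq (is_deriveD (is_deriveX 2 dwi) (is_deriveX 2 dzi))).
  by rewrite /GRing.scale /= ?expr1; ring.
have dE_le (s : R) : dE s <= C * E s.
  have -> : C * E s = E s + \sum_i \sum_j `|A i j| * (2 * E s).
    rewrite /C mulrDl mul1r; congr (_ + _).
    rewrite -mulrA mulrCA mulr_suml; apply: eq_bigr => i _.
    by rewrite mulr_suml.
  rewrite {1}EE -big_split /=; apply: ler_sum => i _; apply: lerD.
    by have := sqr_ge0 (w i s - z i s); lra.
  rewrite mulr_sumr; apply: ler_sum => j _.
  have -> : 2 * z i s * (A i j * w j s) = A i j * (2 * (z i s * w j s)) by ring.
  apply: le_trans (ler_norm _) _; rewrite normrM ler_wpM2l// normrM gtr0_norm//.
  rewrite ler_pM2l// ler_norml.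
  have := leE i s; have := leE j s.
  have := sqr_ge0 (z i s - w j s); have := sqr_ge0 (z i s + w j s).
  have := sqr_ge0 (w i s); have := sqr_ge0 (z j s).
  by move=> *; apply/andP; split; lra.
pose G : R -> R := E * (fun s => expR (- C * s)).
have dG (s : R) : 0 < s -> is_derive s 1 G ((dE s - C * E s) * expR (- C * s)).
  move=> s0; have d1 := dEE s s0.
  have d2 : is_derive s 1 (fun s => expR (- C * s)) (- C * expR (- C * s)).
    by apply: is_derive_eq; rewrite /GRing.scale /=; ring.
  by apply: is_derive_eq; rewrite /GRing.scale /=; ring.
have cG : {within `[0, t], continuous G}.
  apply/continuous_within_itvP => //; split.
  - move=> s; rewrite in_itv /= => /andP[/dG[+ _] _].
    by move=> /derivable1_diffP/differentiable_continuous.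
  - apply: cvgM; last first.
      by apply: cvg_at_right_filter; apply: continuous_comp;
        [exact: mulrl_continuous|exact: continuous_expR].
    have -> : E 0 = \sum_i (w i 0 ^+ 2 + z i 0 ^+ 2) by [].
    have -> : E = (fun s => \sum_i (w i s ^+ 2 + z i s ^+ 2)) by apply/funext.
    apply: cvg_big => [|i _]; first exact: add_continuous.
    apply: cvgD; rewrite expr2.
      by apply: cvgM; exact: onesided_right_cvg (dw i).
    by apply: cvgM; exact: onesided_right_cvg (dz i).
  - apply: cvg_at_left_filter; have [+ _] := dG t t0.
    by move=> /derivable1_diffP/differentiable_continuous.
have dGo (s : R) : s \in `]0, t[%R -> is_derive s 1 G ((dE s - C * E s) * expR (- C * s)).
  by rewrite in_itv /= => /andP[/dG].
have [s _ GE] := MVT_segment (ltW t0) dGo cG.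
have G0 : G 0 = 0.
  by rewrite /G /= fctE EE big1 ?mul0r// => i _; rewrite w0 z0 expr0n addr0.
have Et : E t <= 0.
  rewrite -(pmulr_lle0 _ (expR_gt0 (- C * t))).
  have -> : E t * expR (- C * t) = G t - G 0 by rewrite G0 subr0.
  rewrite GE subr0 mulr_le0_ge0 ?(ltW t0)// mulr_le0_ge0 ?expR_ge0//.
  by rewrite subr_le0.
move=> i; apply/eqP; rewrite -sqrf_eq0 eq_le sqr_ge0 andbT.
by apply: le_trans Et; apply: le_trans (leE i t); rewrite lerDl sqr_ge0.
Qed.

Section Modes.
Local Open Scope complex_scope.
Variable n : nat.

Lemma fourier_ode_unique (M : 'cV[int]_n -> 'M[R]_n) (b : pdistr R n)
    (U V U' V' : R -> pdistr R n) :
  (forall k, U 0 k = 0) -> (forall k, V 0 k = 0) ->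
  (forall t, 0 <= t -> time_derivative U t (V t)) ->
  (forall t, 0 <= t ->
     time_derivative V t (fun k => fourier_multiplier M (U t) k + b k)) ->
  (forall k, U' 0 k = 0) -> (forall k, V' 0 k = 0) ->
  (forall t, 0 <= t -> time_derivative U' t (V' t)) ->
  (forall t, 0 <= t ->
     time_derivative V' t (fun k => fourier_multiplier M (U' t) k + b k)) ->
  forall t, 0 <= t -> forall k, U t k = U' t k.
Proof.
move=> U0 V0 dU dV U0' V0' dU' dV' t t0 k.
(* real and imaginary parts obey the same real system *)
have real_part (r : R[i] -> R) : (forall x y, r (x + y) = r x + r y) ->
    (forall a x, r (a%:C * x) = a * r x) -> (forall x, `|r x| <= normc x) ->
    forall i, r (U t k i 0) = r (U' t k i 0).
  move=> rD rZ rle i.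
  have r0 : r 0 = 0 by rewrite -(mul0r 0) -[X in X * _](rmorph0 (real_complex R)) rZ mul0r.
  have rB x y : r (x - y) = r x - r y.
    rewrite rD; congr (_ + _); rewrite -mulN1r -[RHS]mulN1r -rZ; congr (r (_ * _)).
    by rewrite rmorphN1.
  have rsum (F : 'I_n -> R[i]) : r (\sum_j F j) = \sum_j r (F j).
    exact: (big_morph r rD r0).
  have part (f g : R -> pdistr R n) j :
      (forall t, 0 <= t -> time_derivative f t (g t)) ->
      onesided_derivative (fun t => r (f t k j 0)) (fun t => r (g t k j 0)).
    move=> fg s s0; have := fg s s0 k j => H.
    apply: (@cvg_sub0 _ _ _ _ _ _ (fun=> r (g s k j 0))); last exact: cvg_cst.
    apply: norm_cvg0; apply: (squeeze_cvgr _ (cvg_cst 0) H).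
    apply: nearW => h; rewrite normr_ge0 /=.
    apply: le_trans (rle _); rewrite rB rZ rB.
    by rewrite le_eqVlt; apply/orP; left.
  pose w i t := r (U t k i 0) - r (U' t k i 0).
  pose z i t := r (V t k i 0) - r (V' t k i 0).
  have sub (f g f' g' : R -> R) : onesided_derivative f g ->
      onesided_derivative f' g' ->
      onesided_derivative (fun t => f t - f' t) (fun t => g t - g' t).
    move=> fg fg' s s0.
    have -> : (fun h => h^-1 * (f (s + h) - f' (s + h) - (f s - f' s))) =
        (fun h => h^-1 * (f (s + h) - f s) - h^-1 * (f' (s + h) - f' s)).
      by apply/funext => h; ring.
    exact: cvgB (fg s s0) (fg' s s0).
  have rM (g : 'cV[R[i]]_n) l : r ((map_mx (real_complex R) (M k) *m g) l 0) =
      \sum_j M k l j * r (g j 0).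
    by rewrite mxE rsum; apply: eq_bigr => j _; rewrite mxE rZ.
  apply/eqP; rewrite -subr_eq0; apply/eqP.
  apply: (@linear_ode_unique n (M k) w z) => // {}i.
  - by rewrite /w U0 U0' subrr.
  - by rewrite /z V0 V0' subrr.
  - by apply: sub; apply: part.
  have := sub _ _ _ _ (part _ _ i dV) (part _ _ i dV').
  congr onesided_derivative; apply/funext => s.
  have addE (x y : 'cV[R[i]]_n) : (x + y) i 0 = x i 0 + y i 0 by rewrite mxE.
  rewrite !addE !rD opprD addrACA subrr addr0.
  rewrite /fourier_multiplier !rM -sumrB; apply: eq_bigr => j _.
  by rewrite -mulrBr.
apply/matrixP => i j; rewrite ord1.
have ReE := @real_part (@complex.Re R); have ImE := @real_part (@complex.Im R).
apply/eqP; rewrite eq_complex; apply/andP; split; apply/eqP.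
- apply: ReE => [[? ?] [? ?]//|a [x y] /=|[x y] /=]; first by rewrite mul0r subr0.
  by rewrite -(sqrtr_sqr x) ler_wsqrtr// lerDl sqr_ge0.
- apply: ImE => [[? ?] [? ?]//|a [x y] /=|[x y] /=]; first by rewrite mul0r addr0.
  by rewrite -(sqrtr_sqr y) ler_wsqrtr// lerDr sqr_ge0.
Qed.
End Modes.
End Uniqueness.

(** * Dominated convergence in Sobolev norms *)

Section Tannery.
Context {R : realType} {T : choiceType}.

Lemma esum_scale_lty (K : R) (g : T -> R) : 0 <= K ->
  (\esum_(k in setT) (g k)%:E < +oo)%E -> (\esum_(k in setT) (K * g k)%:E < +oo)%E.
Proof.
move=> K0 gfin; apply: (@le_lt_trans _ _ (K%:E * \esum_(k in setT) (g k)%:E)%E).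
  apply: ge_ereal_sup => _ [X [finX _] <-].
  rewrite fsbig_finite//= sumEFin -mulr_sumr EFinM -sumEFin.
  apply: lee_wpmul2l; first by rewrite lee_fin.
  by apply: esum_ge; exists X => //; rewrite fsbig_finite.
have [->|K1] := eqVneq K 0; first by rewrite mul0e ltry.
by rewrite lte_mul_pinfty// lee_fin.
Qed.

(** Finitely many terms carry all but [e / 2] of the dominating sum, and on these
    the convergence is uniform. *)
Lemma tannery (I : Type) (F : set_system I) (FF : Filter F)
    (a : I -> T -> R) (g : T -> R) :
  (forall i k, 0 <= a i k) ->
  (\forall i \near F, forall k, a i k <= g k) ->
  (\esum_(k in setT) (g k)%:E < +oo)%E ->
  (forall k, a i k @[i --> F] --> (0 : R)) ->
  forall e : R, 0 < e ->
  \forall i \near F, (\esum_(k in setT) (a i k)%:E <= e%:E)%E.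
Proof.
move=> a0 ag gfin acvg e e0.
have [g0|ng0] := pselect (forall k, 0 <= g k); last first.
  apply: filterS ag => i agi; exfalso; apply: ng0 => k.
  exact: le_trans (agi k).
have e2 : 0 < e / 2 by rewrite divr_gt0.
have gpos k : [set: T] k -> (0 <= (g k)%:E)%E by rewrite lee_fin.
have gfn : \esum_(k in setT) (g k)%:E \is a fin_num.
  by rewrite ge0_fin_numE// esum_ge0.
have [_ [X [finX _] <-] gX] := ub_ereal_sup_adherent e2 gfn.
have tail : (\esum_(k in setT `&` ~` X) (g k)%:E <= (e / 2)%:E)%E.
  have E := esumID X setT (fun k => (g k)%:E) gpos.
  have EX : \esum_(k in setT `&` X) (g k)%:E = \sum_(k \in X) (g k)%:E.
    by rewrite setTI esum_fset// => k _; rewrite lee_fin.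
  have gX' : (\esum_(k in setT) (g k)%:E - (e / 2)%:E < \sum_(k \in X) (g k)%:E)%E := gX.
  have Xfin : \sum_(k \in X) (g k)%:E \is a fin_num by rewrite fsbig_finite//= sumEFin.
  move: gX'; rewrite lteBlDr// E EX lteD2lE// => /ltW; exact.
have heads : \forall i \near F, \sum_(k <- fset_set X) a i k <= e / 2.
  have c0 : \sum_(k <- fset_set X) a i k @[i --> F] --> (0 : R).
    have : \sum_(k <- fset_set X) a i k @[i --> F] --> \sum_(k <- fset_set X) (0 : R).
      by apply: cvg_big => [|k _]; [exact: add_continuous|exact: acvg].
    by rewrite big1.
  by apply: cvgr_le c0 _ e2.
apply: filterS2 ag heads => i agi hi.
have apos k : [set: T] k -> (0 <= (a i k)%:E)%E by rewrite lee_fin.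
rewrite (esumID X setT (fun k => (a i k)%:E) apos).
have -> : e%:E = ((e / 2)%:E + (e / 2)%:E)%E by rewrite -EFinD -splitr.
apply: leeD.
  rewrite setTI esum_fset// => [|k _]; last by rewrite lee_fin.
  by rewrite fsbig_finite//= sumEFin lee_fin.
apply: le_trans tail; apply: le_esum => k _; by rewrite lee_fin.
Qed.

End Tannery.

Section Sobolev.
Context {R : realType} (n : nat).
Implicit Types (k : 'cV[int]_n) (g : pdistr R n) (q : R).

Lemma sqnormC_ge0 (z : 'cV[R[i]]_n) : 0 <= sqnormC z.
Proof. by apply: sumr_ge0 => i _; exact: sqr_ge0. Qed.

Lemma inH_le q q' g : q <= q' -> inH q' g -> inH q g.
Proof.
move=> qq; apply: le_lt_trans; apply: gt0_ler_poweR.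
- by rewrite invr_ge0.
- by rewrite in_itv/= leey esum_ge0// => k _; rewrite lee_fin mulr_ge0 ?powR_ge0 ?sqnormC_ge0.
- by rewrite in_itv/= leey esum_ge0// => k _; rewrite lee_fin mulr_ge0 ?powR_ge0 ?sqnormC_ge0.
apply: le_esum => k _; rewrite lee_fin ler_wpM2r ?sqnormC_ge0//.
by rewrite ler_powR// lerDl sqnorm_ge0.
Qed.

Lemma freq_sqnorm_ge1 k : k != 0 -> 1 <= sqnorm (freq R k).
Proof.
move=> k0; have [i ki] : exists i, k i 0 != 0.
  apply/existsP; apply: contraNT k0; rewrite negb_exists => /forallP k0.
  apply/eqP/matrixP => i j; rewrite ord1 mxE; apply/eqP.
  by have := k0 i; rewrite negbK.
rewrite /sqnorm (bigD1 i)//=; apply: ler_wpDr.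
  by apply: sumr_ge0 => j _; exact: sqr_ge0.
by rewrite mxE -rmorphXn /= ler1z -gtz0_ge1 exprn_even_gt0//= ki orbT.
Qed.

Lemma normc_ge0 (x : R[i]) : 0 <= normc x.
Proof. by case: x => x y; exact: sqrtr_ge0. Qed.

Lemma freq_proj_le1 k i j : `|freq_proj R k i j| <= 1.
Proof.
rewrite /freq_proj; set v := freq R k.
rewrite mxE [(_ *m _) i j]mxE big_ord1 [v^T _ _]mxE.
have s0 : 0 <= sqnorm v := sqnorm_ge0 v.
have [->|sn0] := eqVneq (sqnorm v) 0; first by rewrite invr0 mul0r normr0.
have sp : 0 < sqnorm v by rewrite lt_def sn0.
have le l : v l 0 ^+ 2 <= sqnorm v.
  by rewrite /sqnorm (bigD1 l)//= lerDl sumr_ge0// => ? _; exact: sqr_ge0.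
rewrite normrM normfV (gtr0_norm sp) mulrC ler_pdivrMr// mul1r ler_norml.
have := le i; have := le j.
have := sqr_ge0 (v i 0 - v j 0); have := sqr_ge0 (v i 0 + v j 0).
by move=> *; apply/andP; split; lra.
Qed.

(** The entries of the projection being bounded by [1], those of the matrix are at
    most [2 A]; the constant is crude but only has to be independent of [k]. *)
Lemma sqnormC_freq_fun k (g1 g2 : R) (z : 'cV[R[i]]_n) :
  sqnormC (map_mx (real_complex R) (freq_fun id g1 g2 k) *m z) <=
  4 * n%:R ^+ 3 * (`|g1| + `|g2|) ^+ 2 * sqnormC z.
Proof.
set A := `|g1| + `|g2|; have A0 : 0 <= A by rewrite addr_ge0.
set N := Num.sqrt (sqnormC z).
have N2 : N ^+ 2 = sqnormC z by rewrite sqr_sqrtr// sqnormC_ge0.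
have zN j : normc (z j 0) <= N.
  rewrite -[leLHS](ger0_norm (normc_ge0 _)) -sqrtr_sqr ler_wsqrtr//.
  by rewrite /sqnormC (bigD1 j)//= lerDl sumr_ge0// => ? _; exact: sqr_ge0.
have entry i j : `|freq_fun id g1 g2 k i j| <= 2 * A.
  have -> : freq_fun id g1 g2 k i j =
      g1 * freq_proj R k i j + g2 * ((i == j)%:R - freq_proj R k i j).
    by rewrite /freq_fun; move: (freq_proj R k) => P; rewrite !mxE.
  apply: le_trans (ler_normD _ _) _; rewrite !normrM.
  have p1 := freq_proj_le1 k i j.
  have p2 : `|(i == j)%:R - freq_proj R k i j| <= 2.
    apply: le_trans (ler_normB _ _) _; have : `|(i == j)%:R : R| <= 1.
      by case: (i == j); rewrite ?normr1 ?normr0.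
    by lra.
  have := ler_wpM2l (normr_ge0 g1) p1; have := ler_wpM2l (normr_ge0 g2) p2.
  by rewrite /A; have := normr_ge0 g1; lra.
have row i : normc ((map_mx (real_complex R) (freq_fun id g1 g2 k) *m z) i 0)
    <= n%:R * (2 * A * N).
  rewrite mxE; apply: (@le_trans _ _ (\sum_(j < n) (2 * A * N))); last first.
    by rewrite sumr_const card_ord [leRHS]mulr_natl.
  elim/big_ind2 : _ => [|x1 x2 y1 y2 h1 h2|j _].
  - by rewrite /= expr0n/= addr0 sqrtr0.
  - exact: le_trans (le_normcD _ _) (lerD h1 h2).
  rewrite normcM mxE /= expr0n/= addr0 sqrtr_sqr.
  by apply: ler_pM => //; exact: normc_ge0.
rewrite -N2; apply: (@le_trans _ _ (\sum_(i < n) (n%:R * (2 * A * N)) ^+ 2)).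
  apply: ler_sum => i _; rewrite ler_pXn2r// ?nnegrE ?normc_ge0//.
  exact: le_trans (normc_ge0 _) (row i).
by rewrite sumr_const card_ord -[leLHS]mulr_natl le_eqVlt; apply/orP; left; apply/eqP; ring.
Qed.

(** The eigenvalue function of the explicit solution, that is
    [int_0^t sin (omega s) / omega ds] with [omega = sqrt (- x)]. *)
Definition duhamel (t x : R) : R := (cos (Num.sqrt (- x) * t) - 1) / x.

Lemma duhamel_le (t x m : R) : 0 < m -> m <= - x -> `|duhamel t x| <= 2 / m.
Proof.
move=> m0 mx; rewrite /duhamel normrM normfV; apply: ler_pM => //.
  by have := cos_le1 (Num.sqrt (- x) * t); have := cos_geN1 (Num.sqrt (- x) * t);
    rewrite ler_norml => *; apply/andP; split; lra.
by rewrite ler0_norm ?lef_pV2 ?posrE//; lra.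
Qed.

Lemma duhamel_cvg (t l : R) (I : Type) (F : set_system I) (FF : Filter F) (x : I -> R) :
  l < 0 -> x i @[i --> F] --> l -> duhamel t (x i) @[i --> F] --> duhamel t l.
Proof.
move=> l0 xl; apply: cvgM; last by apply: cvgV => //; rewrite lt_eqF.
apply: cvgB; last exact: cvg_cst.
have sl : Num.sqrt (- x i) @[i --> F] --> Num.sqrt (- l).
  exact: (cvg_comp _ _ (cvgN xl) (@sqrt_continuous R _)).
have stl : Num.sqrt (- x i) * t @[i --> F] --> Num.sqrt (- l) * t.
  exact: cvgMr_tmp.
exact: (cvg_comp _ _ stl (@continuous_cos R _)).
Qed.

Lemma explicit_solution_sub (l1 l2 m1 m2 : 'cV[int]_n -> R) (b : pdistr R n) t k :
  k != 0 ->
  explicit_solution l1 l2 b t k - explicit_solution m1 m2 b t k =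
  map_mx (real_complex R) (freq_fun id (duhamel t (l1 k) - duhamel t (m1 k))
    (duhamel t (l2 k) - duhamel t (m2 k)) k) *m b k.
Proof.
move=> k0; rewrite /explicit_solution (negbTE k0) -mulmxBl -map_mxB.
congr (map_mx _ _ *m _); rewrite /freq_fun /duhamel /= opprD addrACA.
by rewrite !scalerBl.
Qed.

End Sobolev.

(** * Convergence of modes and of Sobolev norms *)

Section ModeEstimates.
Context {R : realType} (n : nat).
Implicit Types (k : 'cV[int]_n) (b : pdistr R n).

Lemma explicit_solution_sub_le (l1 l2 m1 m2 : 'cV[int]_n -> R) b (t : R) k :
  k != 0 ->
  sqnormC (explicit_solution l1 l2 b t k - explicit_solution m1 m2 b t k) <=
  4 * n%:R ^+ 3 * (`|duhamel t (l1 k) - duhamel t (m1 k)| +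
                   `|duhamel t (l2 k) - duhamel t (m2 k)|) ^+ 2 * sqnormC (b k).
Proof. by move=> k0; rewrite explicit_solution_sub//; exact: sqnormC_freq_fun. Qed.

(** Each of the four values of [duhamel] is at most [2 / M], and [M^2] is, up
    to [m^2], the excess of the Sobolev weight over that of [b]. *)
Lemma weighted_mode_le (l1 l2 m1 m2 : 'cV[int]_n -> R) b (t S e m : R) k :
  0 < m -> k != 0 -> 
  let w := 1 + sqnorm (freq R k) in
  let M := m * w `^ (1 - e) in
  M <= - l1 k -> M <= - l2 k -> M <= - m1 k -> M <= - m2 k ->
  w `^ (S + 2 - 2 * e) *
    sqnormC (explicit_solution l1 l2 b t k - explicit_solution m1 m2 b t k) <=
  4 * n%:R ^+ 3 * (8 / m) ^+ 2 * (w `^ S * sqnormC (b k)).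
Proof.
move=> m0 k0 w M h1 h2 h3 h4.
have w0 : 0 < w by rewrite /w; have := sqnorm_ge0 (freq R k); lra.
have W0 : 0 < w `^ (1 - e) by rewrite powR_gt0.
have M0 : 0 < M by rewrite mulr_gt0.
have d l l' : M <= - l -> M <= - l' -> `|duhamel t l - duhamel t l'| <= 4 / M.
  move=> hl hl'; apply: le_trans (ler_normB _ _) _.
  have := duhamel_le t M0 hl; have := duhamel_le t M0 hl'; lra.
have sum_le : (`|duhamel t (l1 k) - duhamel t (m1 k)| +
               `|duhamel t (l2 k) - duhamel t (m2 k)|) ^+ 2 <= (8 / M) ^+ 2.
  rewrite ler_pXn2r// ?nnegrE ?addr_ge0 ?divr_ge0 ?(ltW M0)//.
  have := d _ _ h1 h3; have := d _ _ h2 h4; lra.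
apply: le_trans (ler_wpM2l (powR_ge0 _ _) (explicit_solution_sub_le _ _ _ _ _ _ k0)) _.
have powE : w `^ (S + 2 - 2 * e) = w `^ S * (w `^ (1 - e)) ^+ 2.
  rewrite -powR_mulrn ?powR_ge0// -powRrM -powRD; last by rewrite (gt_eqF w0) implybT.
  by congr (_ `^ _); ring.
have -> : 4 * n%:R ^+ 3 * (8 / m) ^+ 2 * (w `^ S * sqnormC (b k)) =
    w `^ (S + 2 - 2 * e) * (4 * n%:R ^+ 3 * (8 / M) ^+ 2 * sqnormC (b k)).
  by rewrite powE /M; field; rewrite (gt_eqF m0) (gt_eqF W0).
rewrite ler_wpM2l ?powR_ge0// ler_wpM2r ?sqnormC_ge0// ler_wpM2l//.
Qed.

Lemma mode_cvg0 (I : Type) (F : set_system I) (FF : Filter F)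
    (l1 l2 : I -> 'cV[int]_n -> R) (m1 m2 : 'cV[int]_n -> R) b (t w : R) k :
  0 <= w -> k != 0 -> m1 k < 0 -> m2 k < 0 ->
  l1 i k @[i --> F] --> m1 k -> l2 i k @[i --> F] --> m2 k ->
  w * sqnormC (explicit_solution (l1 i) (l2 i) b t k -
               explicit_solution m1 m2 b t k) @[i --> F] --> (0 : R).
Proof.
move=> w0 k0 m10 m20 c1 c2.
pose B i := w * (4 * n%:R ^+ 3 * (`|duhamel t (l1 i k) - duhamel t (m1 k)| +
   `|duhamel t (l2 i k) - duhamel t (m2 k)|) ^+ 2 * sqnormC (b k)).
have dist (l : I -> 'cV[int]_n -> R) (m : 'cV[int]_n -> R) : m k < 0 -> l i k @[i --> F] --> m k ->
    `|duhamel t (l i k) - duhamel t (m k)| @[i --> F] --> (0 : R).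
  move=> mk cl; rewrite -(normr0 R) -(subrr (duhamel t (m k))).
  apply: cvg_norm; apply: cvgB; last exact: cvg_cst.
  exact: (@duhamel_cvg R t (m k) I F FF (l^~ k) mk cl).
have B0 : B i @[i --> F] --> (0 : R).
  have -> : (0 : R) = w * (4 * n%:R ^+ 3 * ((0 + 0) * (0 + 0)) * sqnormC (b k)).
    by ring.
  apply: cvgMl_tmp; apply: cvgMr_tmp; apply: cvgMl_tmp; rewrite /=.
  by apply: cvgM; apply: cvgD; exact: dist.
apply: (squeeze_cvgr _ (cvg_cst 0) B0); apply: nearW => i.
by rewrite mulr_ge0 ?sqnormC_ge0//= ler_wpM2l// explicit_solution_sub_le.
Qed.

Lemma Hnorm_le (q d : R) (g : pdistr R n) : 0 <= d ->
  (\esum_(k in setT) ((1 + sqnorm (freq R k)) `^ q * sqnormC (g k))%:E <= (d ^+ 2)%:E)%E ->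
  (Hnorm q g <= d%:E)%E.
Proof.
move=> d0 H; apply: (@le_trans _ _ (poweR (d ^+ 2)%:E 2^-1)).
  apply: gt0_ler_poweR => //; rewrite ?invr_ge0// in_itv/= leey.
    by rewrite esum_ge0// => k _; rewrite lee_fin mulr_ge0 ?powR_ge0 ?sqnormC_ge0.
  by rewrite lee_fin sqr_ge0.
by rewrite poweR_EFin powR12_sqrt ?sqr_ge0// sqrtr_sqr ger0_norm.
Qed.

Lemma Hnorm_cvg0 (I : Type) (F : set_system I) (FF : Filter F) (q : R) (g : I -> pdistr R n) :
  (forall d : R, 0 < d -> \forall i \near F, (Hnorm q (g i) <= d%:E)%E) ->
  Hnorm q (g i) @[i --> F] --> 0%E.
Proof.
move=> H.
have fin d i : (Hnorm q (g i) <= d%:E)%E -> Hnorm q (g i) \is a fin_num.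
  move=> h; rewrite ge0_fin_numE ?poweR_ge0//; exact: le_lt_trans h (ltry _).
apply/fine_cvgP; split; first by apply: filterS (H 1 ltr01) => i; exact: fin.
apply/cvgr0Pnorm_le => d d0; apply: filterS (H d d0) => i h /=.
rewrite ger0_norm ?fine_ge0 ?poweR_ge0//.
by rewrite -lee_fin fineK//; exact: fin h.
Qed.

End ModeEstimates.

Theorem theorem29 (R : realType) (n : nat) (mu lam delta S : R)
    (b : pdistr R n) (U : R -> R -> pdistr R n) (UN : R -> pdistr R n)
    (n_ge1 : (1 <= n)%N)
    (mu_gt0 : 0 < mu) (lam_mu_gt0 : 0 < lam + 2 * mu)
    (delta_gt0 : 0 < delta)
    (lambda1_lt0 : forall (beta : R) (v : 'cV[R]_n),
       beta < n%:R + 2 -> v != 0 -> lambda1 mu lam delta beta v < 0)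
    (lambda2_lt0 : forall (beta : R) (v : 'cV[R]_n),
       beta < n%:R + 2 -> v != 0 -> lambda2 mu delta beta v < 0)
    (bH : inH S b)
    (U_sol : forall beta : R, beta < n%:R + 2 ->
       is_solution (peridynamic_op mu lam delta beta) b
         (S + Num.max 0 (beta - n%:R)) (U beta))
    (UN_sol : is_solution (navier_op mu lam) b (S + 2) UN)
    (t : R) (t_ge0 : 0 <= t)
    (eps : R) (eps_gt0 : 0 < eps) (eps_lt2 : eps < 2) :
  cvg_inH ((n%:R + 2 : R)^'-) (S + 2 - eps) (fun beta : R => U beta t) (UN t).
Proof.
pose l1 beta (k : 'cV[int]_n) := lambda1 mu lam delta beta (freq R k).
pose l2 beta (k : 'cV[int]_n) := lambda2 mu delta beta (freq R k).
pose m1 (k : 'cV[int]_n) := - (lam + 2 * mu) * sqnorm (freq R k).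
pose m2 (k : 'cV[int]_n) := - mu * sqnorm (freq R k).
have UE beta k : beta < n%:R + 2 ->
    U beta t k = explicit_solution (l1 beta) (l2 beta) b t k.
  move=> bn; have [_ [V [U0 V0 dU dV]]] := U_sol beta bn.
  have := explicit_solution_peridynamic b
    (fun v => @lambda1_lt0 beta v bn) (fun v => @lambda2_lt0 beta v bn).
  by move=> [X0 Y0 dX dY]; exact: (fourier_ode_unique U0 V0 dU dV X0 Y0 dX dY).
have UNE k : UN t k = explicit_solution m1 m2 b t k.
  have [_ [V [U0 V0 dU dV]]] := UN_sol.
  have [X0 Y0 dX dY] := explicit_solution_navier b mu_gt0 lam_mu_gt0.
  exact: (fourier_ode_unique U0 V0 dU dV X0 Y0 dX dY).
pose w (k : 'cV[int]_n) := 1 + sqnorm (freq R k).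
pose e := eps / 2.
have qE : S + 2 - eps = S + 2 - 2 * e by rewrite /e; field.
have e1 : e < 1 by rewrite /e; lra.
have e0 : 0 < e by rewrite /e; lra.
have [m m0 lower] := lambda_cutoff n_ge1 delta mu_gt0 lam_mu_gt0.
(* [M] is a common lower bound constant for the peridynamic and Navier multipliers *)
pose c := (2 * Num.max 1 (delta ^+ 2 / 4))^-1.
have c0 : 0 < c by rewrite invr_gt0 mulr_gt0// lt_max ltr01.
pose M := Num.min (m * c) (Num.min ((lam + 2 * mu) / 2) (mu / 2)).
have M0 : 0 < M by rewrite !lt_min mulr_gt0//= !divr_gt0.
have navier_lower k : k != 0 ->
    M * w k `^ (1 - e) <= - m1 k /\ M * w k `^ (1 - e) <= - m2 k.
  move=> /(@freq_sqnorm_ge1 R) s1; have w1 : 1 <= w k by rewrite /w; lra.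
  have W1 : w k `^ (1 - e) <= 2 * sqnorm (freq R k).
    apply: (@le_trans _ _ (w k)); last by rewrite /w; lra.
    by apply: ler1_powR => //; lra.
  have W0 := powR_ge0 (w k) (1 - e).
  have half x : 0 < x -> M <= x / 2 -> M * w k `^ (1 - e) <= x * sqnorm (freq R k).
    move=> x0 Mx; apply: le_trans (ler_pM (ltW M0) W0 Mx W1) _.
    by rewrite le_eqVlt; apply/orP; left; apply/eqP; field.
  rewrite /m1 /m2 !mulNr !opprK; split; apply: half => //.
    by rewrite !ge_min lexx orbT.
  by rewrite !ge_min lexx !orbT.
have peri_lower : \forall beta \near (n%:R + 2 : R)^'-, forall k, k != 0 ->
    M * w k `^ (1 - e) <= - l1 beta k /\ M * w k `^ (1 - e) <= - l2 beta k.
  near=> beta => k /(@freq_sqnorm_ge1 R) s1.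
  have a0 : 0 < gap n beta by near: beta; exact: gap_gt0_near.
  have ae : gap n beta <= e.
    by near: beta; apply: cvgr_le (gap_cvg0 n) _ e0.
  have ge_lam l : m * (sqnorm (freq R k) *
      cutoff_pow (gap n beta) (scaled_sqnorm delta (freq R k))) <= l ->
      M * w k `^ (1 - e) <= l.
    apply: le_trans; apply: (@le_trans _ _ (m * c * w k `^ (1 - e))).
      by rewrite ler_wpM2r ?powR_ge0// ge_min lexx.
    rewrite -mulrA ler_pM2l//; apply: sqnorm_cutoff_ge => //.
    by rewrite a0.
  have bounds : forall v : 'cV[R]_n,
      let tau := cutoff_pow (gap n beta) (scaled_sqnorm delta v) in
      m * (sqnorm v * tau) <= - lambda1 mu lam delta beta v /\
      m * (sqnorm v * tau) <= - lambda2 mu delta beta v by near: beta.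
  by have [/ge_lam L1 /ge_lam L2] := bounds (freq R k).
pose a beta k := w k `^ (S + 2 - eps) *
  sqnormC (explicit_solution (l1 beta) (l2 beta) b t k - explicit_solution m1 m2 b t k).
have mode0 beta : a beta 0 = 0.
  rewrite /a /explicit_solution eqxx subrr /sqnormC big1 ?mulr0// => i _.
  by rewrite mxE /= expr0n /= addr0 sqrtr0 expr0n.
have small (d : R) : 0 < d -> \forall beta \near (n%:R + 2 : R)^'-,
    (\esum_(k in [set: 'cV[int]_n]) (a beta k)%:E <= d%:E)%E.
  pose K := 4 * n%:R ^+ 3 * (8 / M) ^+ 2.
  have K0 : 0 <= K by apply: mulr_ge0; [exact: mulr_ge0|exact: sqr_ge0].
  have FF : Filter (n%:R + 2 : R)^'- by exact: _.
  apply: (@tannery R _ R _ FF a (fun k => K * (w k `^ S * sqnormC (b k)))).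
  - by move=> beta k; rewrite mulr_ge0 ?powR_ge0 ?sqnormC_ge0.
  - apply: filterS peri_lower => beta low k.
    have [->|k0] := eqVneq k 0.
      by rewrite mode0; apply: mulr_ge0 => //; rewrite mulr_ge0 ?powR_ge0 ?sqnormC_ge0.
    have [L1 L2] := low k k0; have [N1 N2] := navier_lower k k0.
    by rewrite /a qE; exact: weighted_mode_le.
  - apply: esum_scale_lty => //.
    by move: bH; rewrite /inH /Hnorm; apply: lty_poweRy; rewrite invr_neq0.
  - move=> k; have [->|k0] := eqVneq k 0.
      by under eq_fun do rewrite mode0; exact: cvg_cst.
    have s1 := freq_sqnorm_ge1 (R := R) k0.
    apply: mode_cvg0 => //; first exact: powR_ge0.
    + by rewrite /m1 nmulr_rlt0 ?oppr_lt0//; lra.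
    + by rewrite /m2 nmulr_rlt0 ?oppr_lt0//; lra.
    + exact: lambda1_cvg.
    + exact: lambda2_cvg.
split.
(* the smoothness [S + max (0, beta - n)] is at least [S + 2 - eps] once
   [beta >= n + 2 - eps] *)
- near=> beta.
  have bn : beta < n%:R + 2 by near: beta; exact: nbhs_left_lt.
  have be : n%:R + 2 - eps <= beta.
    by near: beta; apply: nbhs_left_ge; lra.
  have [+ _] := U_sol beta bn => /(_ t t_ge0); apply: inH_le.
  by rewrite -addrA lerD2l le_max; apply/orP; right; lra.
- have [+ _] := UN_sol => /(_ t t_ge0); apply: inH_le; lra.
apply: Hnorm_cvg0 => d d0.
near=> beta; have bn : beta < n%:R + 2 by near: beta; exact: nbhs_left_lt.
apply: Hnorm_le; first exact: ltW.
have -> : (fun k => ((1 + sqnorm (freq R k)) `^ (S + 2 - eps) *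
    sqnormC (U beta t k - UN t k))%:E) = (fun k => (a beta k)%:E).
  by apply/funext => k; rewrite UE// UNE.
by near: beta; apply: small; rewrite exprn_gt0.
Unshelve. all: by end_near. Qed.
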